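(* Let $F$ be an infinite field, $R$ a finite-dimensional associative unital $F$-algebra with Jacobson radical $J$, and write $R/J=\bigoplus_i R_i$ with $R_i$ simple, such that the center of each $R_i$ is separable over $F$. Then the irreducible (nonconstant) multiplicative polynomial functions $R\to F$ are exactly the functions $a\mapsto N_{R_i/F}(\pi_i(a+J))$, where $\pi_i:R/J\to R_i$ is the projection and $N_{R_i/F}$ is the reduced norm of $R_i$. Moreover, the product of these reduced norms, $\prod_i N_{R_i/F}\circ\pi_i$, is the canonical (minimal) Cayley–Hamilton norm of $R/J$.
   Context: Reduced norm: if $T=M_n(D)$ with $D$ a finite-dimensional division $F$-algebra with center $Z$, $[Z:F]=h$, $\dim_ZD=p^2$, and $Z$ separable over $F$, then $T\otimes_F\bar F\cong M_{pn}(\bar F)^h$ ($\bar F$ an algebraic closure), and the reduced norm $N_{T/F}(a)$ is the product of the determinants of the $h$ components of $a\otimes1$; it takes values in $F$. A polynomial function $f$ is multiplicative if $f(ab)=f(a)f(b)$. For a finite-dimensional unital associative $F$-algebra $T$ with basis $a_1,\dots,a_m$, its canonical Cayley–Hamilton norm is $(-1)^kP(0)$, where $P(t)$ of degree $k$ is the minimal polynomial of the generic element $\sum_ix_ia_i$ over $F(x_1,\dots,x_m)$. *)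

(* Defs.v *)
From HB Require Import structures.
From mathcomp Require Import all_boot all_order all_algebra.
From mathcomp Require Import falgebra separable fraction.
From mathcomp Require Import mpoly.
Set Implicit Arguments. Unset Strict Implicit. Unset Printing Implicit Defensive.
Import Order.TTheory GRing.Theory.
Local Open Scope ring_scope.

Section Defs.
Variable F : fieldType.

Section Coords.
Variable A : falgType F.
Definition fbas (i : 'I_(\dim {:A})) : A := tnth (vbasis {:A}) i.
Definition fcrd (a : A) (i : 'I_(\dim {:A})) : F := coord (vbasis {:A}) i a.

(* elements of L (x)_F A are coordinate rows over L in the basis fbas;
   multiplication is given by the structure constants of A *)
Variables (L : fieldType) (iota : F -> L).
Definition ext_mul (v w : 'rV[L]_(\dim {:A})) : 'rV[L]_(\dim {:A}) :=
  \row_k \sum_(i < \dim {:A}) \sum_(j < \dim {:A})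
          v 0 i * w 0 j * iota (fcrd (fbas i * fbas j) k).
Definition ext_one : 'rV[L]_(\dim {:A}) := \row_k iota (fcrd 1 k).
Definition ext_of (a : A) : 'rV[L]_(\dim {:A}) := \row_k iota (fcrd a k).
Definition ext_pow (v : 'rV[L]_(\dim {:A})) (d : nat) := iter d (ext_mul v) ext_one.
Definition ext_horner (P : {poly L}) (v : 'rV[L]_(\dim {:A})) : 'rV[L]_(\dim {:A}) :=
  \sum_(d < size P) P`_d *: ext_pow v d.
End Coords.

Definition alg_hom (A B : falgType F) (f : A -> B) : Prop :=
  [/\ forall (c : F) (a b : A), f (c *: a + b) = c *: f a + f b,
      forall a b : A, f (a * b) = f a * f b
    & f 1 = 1].

Definition jacobson (A : falgType F) (a : A) : Prop :=
  forall x : A, (1 - x * a) \is a GRing.unit.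

Definition two_sided_ideal (A : falgType F) (I : {vspace A}) : Prop :=
  forall x y a : A, a \in I -> x * a * y \in I.

(* simple algebra (falgType already forces 1 != 0) *)
Definition simple_alg (A : falgType F) : Prop :=
  forall I : {vspace A}, two_sided_ideal I -> I = 0%VS \/ I = fullv.

Definition center_separable (A : falgType F) : Prop :=
  forall z : A, (forall x : A, z * x = x * z) ->
    exists p : {poly F}, separable_poly p /\ (map_poly (in_alg A) p).[z] = 0.

(* N is the reduced norm of A : A (x)_F Fbar ~= M_d(Fbar)^h as Fbar-algebras,
   and N a = product of the determinants of the h components of a (x) 1.
   Fbar is an algebraic closure of F (algebraically closed, algebraic over F). *)
Definition is_reduced_norm (A : falgType F) (N : A -> F) : Prop :=
  exists (L : closedFieldType) (iota : {rmorphism F -> L}),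
    (forall x : L, exists p : {poly F}, p != 0 /\ root (map_poly iota p) x) /\
    exists (h d : nat) (psi : 'rV[L]_(\dim {:A}) -> 'I_h -> 'M[L]_d),
      (forall (c : L) v w k, psi (c *: v + w) k = c *: psi v k + psi w k) /\
      (forall v w, (forall k, psi v k = psi w k) -> v = w) /\
      (forall y : 'I_h -> 'M[L]_d, exists v, forall k, psi v k = y k) /\
      (forall v w k, psi (ext_mul iota v w) k = psi v k *m psi w k) /\
      (forall k, psi (ext_one A iota) k = 1%:M) /\
      (forall a : A, iota (N a) = \prod_(k < h) \det (psi (ext_of iota a) k)).

Definition multiplicative_fun (A : falgType F) (f : A -> F) : Prop :=
  forall a b : A, f (a * b) = f a * f b.

Definition poly_fun_rep (A : falgType F) (f : A -> F) (P : {mpoly F[\dim {:A}]}) : Prop :=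
  forall a : A, f a = P.@[fcrd a].

Definition mconst n (P : {mpoly F[n]}) : bool := (msize P <= 1)%N.

Definition mirreducible n (P : {mpoly F[n]}) : Prop :=
  ~~ mconst P /\ forall Q1 Q2 : {mpoly F[n]}, P = Q1 * Q2 -> mconst Q1 \/ mconst Q2.

Definition irred_mult_poly_fun (A : falgType F) (f : A -> F) : Prop :=
  (exists P : {mpoly F[\dim {:A}]}, poly_fun_rep f P /\ mirreducible P) /\
  multiplicative_fun f.

Section CH.
Variable A : falgType F.
Definition genK := {fraction {mpoly F[\dim {:A}]}}.
Definition iotaK (c : F) : genK := tofrac (c%:MP).
(* generic element sum_i x_i a_i in F(x_1..x_m) (x)_F A *)
Definition gen_elt : 'rV[genK]_(\dim {:A}) := \row_i tofrac ('X_i : {mpoly F[\dim {:A}]}).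
Definition min_poly_generic (P : {poly genK}) : Prop :=
  [/\ P \is monic, ext_horner iotaK P gen_elt = 0
    & forall Q : {poly genK}, Q != 0 -> ext_horner iotaK Q gen_elt = 0 ->
        (size P <= size Q)%N].
Definition CH_norm_rep (M : {mpoly F[\dim {:A}]}) : Prop :=
  exists P : {poly genK}, min_poly_generic P /\
    (-1) ^+ (size P).-1 * P`_0 = tofrac M.
End CH.

End Defs.

(* Main.v *)
Require Import Defs.
From HB Require Import structures.
From mathcomp Require Import all_boot all_order all_algebra.
From mathcomp Require Import falgebra separable fraction.
From mathcomp Require Import mpoly.
From Stdlib Require Import Classical.
Import GRing.Theory.
Set Implicit Arguments. Unset Strict Implicit. Unset Printing Implicit Defensive.
Local Open Scope ring_scope.

(** Over an algebraic closure L, a polynomial that does not vanish on the units of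
    M_d(L)^h is constant along t |-> (1 + t N) x for N^2 = 0, hence depends only on
    the h determinants, and is therefore a constant times a product of powers of
    them.  This applies to multiplicative polynomial functions on a simple algebra A
    and to the factors of its reduced norm.  If such a product comes from a polynomial
    P over F, then either all exponents vanish or none does: if det_i occurs in P,
    then P(t - a) kills the i-th component of a by Cayley-Hamilton, hence kills a
    itself because A is simple and embeds into each component, and this polynomial
    identity fails at an element that is 0 where the exponent is positive and 1 in
    another component.  So the reduced norm is irreducible and divides every
    nonconstant multiplicative polynomial function on A.

    A multiplicative polynomial function on R is invariant under the nil ideal J and
    is the product of its restrictions to the factors of R/J, so an irreducible one
    lives on a single simple factor.  The closure L is allowed to vary with the
    factor, so everything passed from one factor to the others is stated over F.

    Finally, prod_i N_i(t - x) kills the generic element x, and it is minimal because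
    R/J contains an element whose minimal polynomial has degree sum_i deg N_i. *)

(** * Polynomials over an infinite field *)

Lemma rmorph_mmap n (R : nzRingType) (B C : comNzRingType) (phi : {rmorphism B -> C})
    (f : R -> B) (h : 'I_n -> B) (P : {mpoly R[n]}) :
  phi (mmap f h P) = mmap (phi \o f) (phi \o h) P.
Proof.
rewrite /mmap rmorph_sum; apply: eq_bigr => m _; rewrite rmorphM /=; congr (_ * _).
by rewrite /mmap1 rmorph_prod; apply: eq_bigr => i _; rewrite rmorphXn.
Qed.

Lemma eq_mmap n (R : nzRingType) (B : comNzRingType) (f g : R -> B) (h h' : 'I_n -> B)
    (P : {mpoly R[n]}) : f =1 g -> h =1 h' -> mmap f h P = mmap g h' P.
Proof.
move=> fg hh; rewrite /mmap; apply: eq_bigr => m _; rewrite fg; congr (_ * _).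
by apply: eq_bigr => i _; rewrite hh.
Qed.

Lemma mmap_gen n (R : comNzRingType) (P : {mpoly R[n]}) :
  mmap (@mpolyC n R) (fun i => 'X_i) P = P.
Proof.
rewrite [RHS]mpolyE /mmap; apply: eq_bigr => m _.
by rewrite mmap1_id mul_mpolyC.
Qed.

Lemma meval_map_mpoly n (R S : comNzRingType) (f : {rmorphism R -> S})
    (h : 'I_n -> S) (P : {mpoly R[n]}) :
  (map_mpoly f P).@[h] = mmap f h P.
Proof.
rewrite /map_mpoly /meval.
rewrite (rmorph_mmap (mmap idfun h)).
apply: eq_mmap => [c|i] /=; first by rewrite mmapC.
by rewrite mmapX mmap1U.
Qed.

Lemma map_mpoly_inj n (R S : fieldType) (f : {rmorphism R -> S}) (P Q : {mpoly R[n]}) :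
  map_mpoly f P = map_mpoly f Q -> P = Q.
Proof.
move=> e; apply/mpolyP => m; apply: (fmorph_inj f).
by rewrite -!mcoeff_map_mpoly e.
Qed.

Section Infinite.
Variables (F : fieldType) (infF : forall s : seq F, exists x : F, x \notin s).

Lemma inf_uniq n : exists s : seq F, uniq s /\ size s = n.
Proof.
elim: n => [|n [s [us ss]]]; first by exists [::].
by have [x xs] := infF s; exists (x :: s); rewrite /= xs us ss.
Qed.

Section Domain.
Variables (B : idomainType) (iota : {rmorphism F -> B}).

Lemma poly_dense (p : {poly B}) : (forall c : F, p.[iota c] = 0) -> p = 0.
Proof.
move=> p0; apply/eqP; apply: contraT => pn0.
have [s [us ss]] := inf_uniq (size p).
have inj : injective iota.
  move=> x y /eqP; rewrite -subr_eq0 -rmorphB => /eqP e.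
  apply/eqP; rewrite -subr_eq0; apply: contraT => xy.
  have := congr1 (fun t => iota (x - y)^-1 * t) e.
  by rewrite /= -rmorphM mulVf // rmorph1 mulr0 => /eqP; rewrite oner_eq0.
have := @max_poly_roots B p (map iota s) pn0.
rewrite size_map ss ltnn => H; apply: H; last by rewrite map_inj_uniq.
by apply/allP => _ /mapP[c _ ->]; apply/rootP.
Qed.

Lemma poly_dense_neq (p : {poly B}) : p != 0 -> exists c : F, p.[iota c] != 0.
Proof.
move=> pn0; apply: NNPP => H; case/eqP: pn0; apply: poly_dense => c.
by apply/eqP; apply: contraT => h; case: H; exists c.
Qed.

(* The coordinates are replaced by arbitrary ring elements one at a time. *)
Lemma mmap_dense n (A : nzRingType) (f : {additive A -> B}) (P : {mpoly A[n]}) :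
  (forall a : 'I_n -> F, mmap f (iota \o a) P = 0) ->
  forall v : 'I_n -> B, mmap f v P = 0.
Proof.
move=> H v.
suff: forall j, forall a : 'I_n -> F,
    mmap f (fun i : 'I_n => if (i < j)%N then v i else iota (a i)) P = 0.
  move=> /(_ n (fun=> 0)) <-; apply: eq_mmap => // i.
  by rewrite ltn_ord.
elim=> [|j IH] a; first by rewrite -[RHS](H a); apply: eq_mmap.
case: (ltnP j n) => jn; last first.
  rewrite -[RHS](IH a); apply: eq_mmap => // i.
  have ij : (i < j)%N by apply: leq_trans (ltn_ord i) jn.
  by rewrite ij ltnS ltnW.
(* Coordinates below [j] are already arbitrary, those above come from [F], and the [j]-th becomes
   the variable of [p], which vanishes on the image of [F]. *)
pose w (i : 'I_n) : {poly B} := if (i < j)%N then (v i)%:P else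
   if i == Ordinal jn then 'X else (iota (a i))%:P.
pose p := mmap (polyC \o f) w P.
have evp c : p.[c] = mmap f (fun i => (w i).[c]) P.
  rewrite -horner_evalE rmorph_mmap; apply: eq_mmap => // x /=.
  by rewrite horner_evalE hornerC.
have p0 : p = 0.
  apply: poly_dense => c; rewrite evp.
  rewrite -[RHS](IH (fun i => if i == Ordinal jn then c else a i)).
  apply: eq_mmap => // i; rewrite /w; case: ifP => _; first by rewrite hornerC.
  by case: ifP => _; rewrite ?hornerX ?hornerC.
have := evp (v (Ordinal jn)); rewrite p0 horner0 => e; rewrite [RHS]e.
apply: eq_mmap => // i; rewrite /w ltnS leq_eqVlt -[(_ == _ :> nat)]/(_ == Ordinal jn).
case: eqP => [->|_] /=; first by rewrite ltnn hornerX.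
by case: ifP => _; rewrite hornerC.
Qed.

End Domain.

(** [mmap_dense] is applied with values in the polynomial ring and [v] the tuple of variables, where
    evaluation gives back [P] itself. *)
Lemma mpoly_dense (B : idomainType) (iota : {rmorphism F -> B}) n (P : {mpoly B[n]}) :
  (forall a : 'I_n -> F, P.@[iota \o a] = 0) -> P = 0.
Proof.
move=> H; rewrite -(mmap_gen P).
pose j : {rmorphism F -> {mpoly B[n]}} := (@mpolyC n B) \o iota.
apply: (@mmap_dense _ j) => a.
have := H a; rewrite /meval => /(congr1 (@mpolyC n B)).
by rewrite rmorph_mmap rmorph0 => <-; apply: eq_mmap.
Qed.

Lemma mpoly_dense_neq (B : idomainType) (iota : {rmorphism F -> B}) n (P : {mpoly B[n]}) :
  P != 0 -> exists a : 'I_n -> F, P.@[iota \o a] != 0.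
Proof.
move=> pn0; apply: NNPP => H; case/eqP: pn0; apply: (@mpoly_dense _ iota) => c.
by apply/eqP; apply: contraT => h; case: H; exists c.
Qed.

Lemma mpoly_denseF n (P : {mpoly F[n]}) : (forall a : 'I_n -> F, P.@[a] = 0) -> P = 0.
Proof. by move=> H; apply: (@mpoly_dense _ idfun) => a; apply: H. Qed.

Lemma mpoly_denseF_neq n (P : {mpoly F[n]}) : P != 0 -> exists a : 'I_n -> F, P.@[a] != 0.
Proof. by move=> H; apply: (@mpoly_dense_neq _ idfun). Qed.

(** * Descent of polynomials to the base field *)

Section Descent.
Variables (L : fieldType) (iota : {rmorphism F -> L}) (n : nat).
Variables (U : {mpoly F[n]}) (U0 : U != 0).

(* If the last scalar is an F-combination of 1 and the other scalars, it can be
   eliminated; otherwise its polynomial has to vanish wherever U does not. *)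
Lemma lincomb_descend r (c : 'I_r -> L) (P : 'I_r -> {mpoly F[n]}) :
  (forall a, U.@[a] != 0 -> exists y, \sum_i c i * iota (P i).@[a] = iota y) ->
  exists P0 : {mpoly F[n]}, \sum_i c i *: map_mpoly iota (P i) = map_mpoly iota P0.
Proof.
elim: r c P => [|r IH] c P H.
  by exists 0; rewrite big_ord0 rmorph0.
set c' := fun i : 'I_r => c (widen_ord (leqnSn r) i).
set P' := fun i : 'I_r => P (widen_ord (leqnSn r) i).
have [[x0 [x cE]]|nspan] :=
   classic (exists x0 (x : 'I_r -> F), c ord_max = iota x0 + \sum_i c' i * iota (x i)).
  have [a Ua|P0 P0E] := IH c' (fun i => P' i + x i *: P ord_max).
    have [y yE] := H a Ua.
    exists (y - x0 * (P ord_max).@[a]).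
    rewrite rmorphB -yE big_ord_recr /= cE mulrDl rmorphM.
    rewrite [_ * _ + _ in RHS]addrC addrA addrK.
    rewrite mulr_suml -big_split /=; apply: eq_bigr => i _.
    by rewrite mevalD mevalZ rmorphD rmorphM mulrDr mulrA addrC.
  exists (P0 + x0 *: P ord_max).
  rewrite rmorphD /= -P0E big_ord_recr /= cE scalerDl map_mpolyZ.
  rewrite addrCA [RHS]addrC; congr (_ + _).
  rewrite scaler_suml -big_split /=; apply: eq_bigr => i _.
  by rewrite rmorphD /= map_mpolyZ scalerDr scalerA.
have Pm0 : P ord_max = 0.
  apply/eqP; apply: contraT => Pn0.
  have [a] := mpoly_denseF_neq (mulf_neq0 U0 Pn0).
  rewrite mevalM mulf_eq0 negb_or => /andP[Ua Pa].
  have [y yE] := H a Ua; case: nspan.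
  exists (y / (P ord_max).@[a]), (fun i => - (P' i).@[a] / (P ord_max).@[a]).
  have nz : iota (P ord_max).@[a] != 0 by rewrite fmorph_eq0.
  apply: (mulIf nz); rewrite mulrDl -rmorphM divfK // -yE big_ord_recr /=.
  rewrite [X in X + _]addrC -addrA mulr_suml -big_split /= big1 ?addr0 // => i _.
  by rewrite -mulrA -rmorphM divfK // rmorphN mulrN addrN.
have [a Ua|P0 P0E] := IH c' P'.
  have [y yE] := H a Ua; exists y; rewrite -yE big_ord_recr /=.
  by rewrite Pm0 meval0 rmorph0 mulr0 addr0.
by exists P0; rewrite big_ord_recr /= Pm0 rmorph0 scaler0 addr0.
Qed.

(** Monomials have coefficients in [F], so [lincomb_descend] applies to the expansion of [P].
    Testing only where [U] is nonzero admits values known as quotients with denominator [U]. *)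
Lemma mpoly_descend (P : {mpoly L[n]}) :
  (forall a, U.@[a] != 0 -> exists y, P.@[iota \o a] = iota y) ->
  exists P0 : {mpoly F[n]}, P = map_mpoly iota P0.
Proof.
move=> H.
pose s := msupp P; pose m (i : 'I_(size s)) := nth 0%MM s i.
have PE : P = \sum_i P@_(m i) *: map_mpoly iota 'X_[m i].
  rewrite {1}[P]mpolyE (big_nth 0%MM) big_mkord; apply: eq_bigr => i _.
  by rewrite map_mpolyX.
have [a Ua|P0 P0E] := @lincomb_descend _ (fun i => P@_(m i)) (fun i => 'X_[m i]).
  have [y yE] := H a Ua; exists y; rewrite -yE {2}PE raddf_sum; apply: eq_bigr => i _ /=.
  rewrite mevalZ; congr (_ * _).
  by rewrite map_mpolyX !mevalX rmorph_prod; apply: eq_bigr => j _; rewrite rmorphXn.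
by exists P0; rewrite {1}PE.
Qed.

End Descent.
End Infinite.

(** * Polynomials without zeros on the invertible matrices *)

Section ClosedField.
Variable L : closedFieldType.

Lemma closed_field_infinite (s : seq L) : exists x : L, x \notin s.
Proof.
case: (posnP (size s)) => [/size0nil->|s0]; first by exists 0.
pose p : {poly L} := \prod_(z <- s) ('X - z%:P) + 1.
have /closed_rootP[x] : size p != 1.
  rewrite /p size_polyDl size_prod_XsubC ?size_poly1 //.
  by rewrite eqSS -lt0n.
rewrite /root /p hornerD hornerC => /eqP px; exists x; apply/negP => xs.
move: px; have /rootP -> : root (\prod_(z <- s) ('X - z%:P)) x by rewrite root_prod_XsubC.
by move/eqP; rewrite add0r oner_eq0.
Qed.

Lemma nonvanishing_const (p : {poly L}) (x y : L) :
  (forall t, p.[t] != 0) -> p.[x] = p.[y].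
Proof.
move=> H; have /eqP/size_poly1P[c _ ->] : size p = 1.
  apply/eqP; apply: contraT => /closed_rootP[t /rootP/eqP].
  by rewrite (negbTE (H t)).
by rewrite !hornerC.
Qed.

Lemma nonvanishing_monomial (p : {poly L}) i j :
  (forall t, t != 0 -> p.[t] != 0) -> p`_i != 0 -> p`_j != 0 -> i = j.
Proof.
move=> H; have [r pE] := closed_field_poly_normal p.
have r0 z : z \in r -> z = 0.
  move=> zr; apply/eqP; apply: contraT => /H.
  rewrite pE hornerZ; have /rootP -> : root (\prod_(z <- r) ('X - z%:P)) z.
    by rewrite root_prod_XsubC.
  by rewrite mulr0 eqxx.
have -> : p = lead_coef p *: 'X^(size r).
  rewrite {1}pE; congr (_ *: _); rewrite big_seq (eq_bigr (fun=> 'X)).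
    by rewrite -big_seq big_const_seq count_predT -Monoid.iteropE.
  by move=> z /r0 ->; rewrite subr0.
rewrite !coefZ !coefXn.
case: (i =P _) => [->|_]; last by rewrite mulr0 eqxx.
by case: (j =P _) => [->|_] //; rewrite mulr0 eqxx.
Qed.

(** Any two monomials of [q] have the same exponent at each [k]: with the other variables fixed
    generically, [q] is univariate without nonzero roots, hence a monomial. *)
Lemma nonvanishing_mmonomial h (q : {mpoly L[h]}) :
  (forall delta : 'I_h -> L, (forall k, delta k != 0) -> q.@[delta] != 0) ->
  exists c m, q = c *: 'X_[m].
Proof.
move=> H.
have q0 : q != 0.
  have := H (fun=> 1) (fun=> oner_neq0 _); apply: contra => /eqP->.
  by rewrite meval0.
suff Hm : forall m m', m \in msupp q -> m' \in msupp q -> m = m'.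
  exists q@_(mlead q), (mlead q); rewrite {1}[q]mpolyE.
  have lq := mlead_supp q0.
  rewrite (bigD1_seq (mlead q)) ?msupp_uniq //= big_seq_cond big1 ?addr0 // => m.
  by case/andP => mq /eqP[]; apply: Hm.
move=> m1 m2 m1q m2q; apply/mnmP => k.
(* The terms of degree [i] in the [k]-th variable. [delta] is taken where the parts of [m1] and [m2]
   survive; the product of the variables keeps it in the torus. *)
pose part i := \sum_(m <- msupp q | m k == i) q@_m *: 'X_[m].
have part0 m : m \in msupp q -> part (m k) != 0.
  move=> mq; have : q@_m != 0 by rewrite -mcoeff_msupp.
  apply: contra => /eqP/(congr1 (mcoeff m)); rewrite mcoeff0 /part raddf_sum /=.
  rewrite -big_filter (bigD1_seq m) ?filter_uniq ?msupp_uniq ?mem_filter ?eqxx //=.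
  rewrite mcoeffZ mcoeffX eqxx mulr1 big1 ?addr0 => [->|m' mm'] //.
  by rewrite mcoeffZ mcoeffX (negbTE mm') mulr0.
have X0 : \prod_(i < h) 'X_i != 0 :> {mpoly L[h]}.
  apply/prodf_neq0 => i _; apply: contraT; rewrite negbK => /eqP/(congr1 (mcoeff U_(i))).
  by rewrite mcoeffX eqxx mcoeff0 => /eqP; rewrite oner_eq0.
have [delta] := mpoly_denseF_neq closed_field_infinite
   (mulf_neq0 (mulf_neq0 (part0 _ m1q) (part0 _ m2q)) X0).
rewrite !mevalM !mulf_eq0 !negb_or rmorph_prod => /andP[/andP[p1 p2] /prodf_neq0 d0].
have {}d0 i : delta i != 0 by have := d0 i isT; rewrite /= mevalXU.
(* [q] along the curve that multiplies the [k]-th coordinate of [delta] by t. *)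
pose p : {poly L} := \sum_(m <- msupp q) (q@_m * \prod_i delta i ^+ m i) *: 'X^(m k).
have pE i : p`_i = (part i).@[delta].
  rewrite /p coef_sum raddf_sum [RHS]big_mkcond; apply: eq_bigr => m _ /=.
  rewrite coefZ coefXn eq_sym; case: eqP => _; last by rewrite mulr0.
  by rewrite mulr1 mevalZ mevalX.
apply: (@nonvanishing_monomial p); rewrite ?pE // => t t0.
have -> : p.[t] = q.@[fun i => if i == k then t * delta i else delta i].
  rewrite /p horner_sum mevalE; apply: eq_bigr => m _.
  rewrite hornerZ hornerXn -mulrA; congr (_ * _).
  rewrite (bigD1 k) //= [in RHS](bigD1 k) //= eqxx exprMn mulrC mulrA; congr (_ * _).
  by apply: eq_bigr => i /negbTE->.
by apply: H => i; case: ifP => _; rewrite ?mulf_neq0.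
Qed.

End ClosedField.

(** * Functions of invertible matrices invariant under elementary operations *)

Section Elementary.
Variables (L : fieldType).

Let sq0 d (N : 'M[L]_d) := N *m N = 0.

(* Row and column operations make any invertible matrix block diagonal
   with an upper left entry 1. *)
Lemma det_invariant (T : Type) d (g : 'M[L]_d.+1 -> T) :
  (forall N x, N *m N = 0 -> \det x != 0 -> g ((1%:M + N) *m x) = g x) ->
  (forall N x, N *m N = 0 -> \det x != 0 -> g (x *m (1%:M + N)) = g x) ->
  forall x y, \det x != 0 -> \det x = \det y -> g x = g y.
Proof.
elim: d g => [|d IH] g gl gr.
  by move=> x y _; rewrite !det_mx11 => e; congr g; apply/matrixP => i j; rewrite !ord1.
have upE (r : 'rV[L]_(d.+1)) : block_mx 1%:M r 0 1%:M
    = 1%:M + block_mx 0 r 0 0 :> 'M[L]_(1 + d.+1).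
  by rewrite (scalar_mx_block 1 d.+1) add_block_mx !addr0 !add0r.
have loE (c : 'cV[L]_(d.+1)) : block_mx 1%:M 0 c 1%:M
    = 1%:M + block_mx 0 0 c 0 :> 'M[L]_(1 + d.+1).
  by rewrite (scalar_mx_block 1 d.+1) add_block_mx !addr0 !add0r.
have up0 (r : 'rV[L]_(d.+1)) : sq0 (block_mx 0 r 0 0 : 'M[L]_(1 + d.+1)).
  by rewrite /sq0 mulmx_block !mulmx0 !mul0mx !addr0 block_mx0.
have lo0 (c : 'cV[L]_(d.+1)) : sq0 (block_mx 0 0 c 0 : 'M[L]_(1 + d.+1)).
  by rewrite /sq0 mulmx_block !mulmx0 !mul0mx !addr0 block_mx0.
have detup (r : 'rV[L]_(d.+1)) : \det (block_mx 1%:M r 0 1%:M) = 1.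
  by rewrite det_ublock !det1 mulr1.
have detlo (c : 'cV[L]_(d.+1)) : \det (block_mx 1%:M 0 c 1%:M) = 1.
  by rewrite det_lblock !det1 mulr1.
pose red (x x' : 'M[L]_(1 + d.+1)) := \det x' = \det x /\ g x' = g x.
have redt x y z : red x y -> red y z -> red x z.
  by move=> [d1 g1] [d2 g2]; split; rewrite ?d2 ?g2.
have redul x r : \det x != 0 -> red x (block_mx 1%:M r 0 1%:M *m x).
  by move=> x0; split; [rewrite det_mulmx detup mul1r | rewrite upE gl //; apply: up0].
have redll x c : \det x != 0 -> red x (block_mx 1%:M 0 c 1%:M *m x).
  by move=> x0; split; [rewrite det_mulmx detlo mul1r | rewrite loE gl //; apply: lo0].
have redur x r : \det x != 0 -> red x (x *m block_mx 1%:M r 0 1%:M).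
  by move=> x0; split; [rewrite det_mulmx detup mulr1 | rewrite upE gr //; apply: up0].
(* If the lower left column is zero, the top row is added to all others. The column stays zero only
   if the upper left entry is 0, and then [x] is singular. *)
have step1 x : \det x != 0 -> exists2 x', red x x' & dlsubmx x' != 0.
  move=> x0; have [c0|] := eqVneq (dlsubmx x) 0; last by exists x.
  exists (block_mx 1%:M 0 (const_mx 1) 1%:M *m x); first exact: redll.
  rewrite -[X in _ *m X]submxK mulmx_block block_mxKdl c0 mulmx0 addr0.
  apply: contra x0 => /eqP/matrixP/(_ 0 0).
  rewrite mxE big_ord1 [X in X * _]mxE mul1r [RHS]mxE => e.
  rewrite -[x]submxK c0 det_ublock det_mx11.
  by rewrite e mul0r.
have step2 x : \det x != 0 -> dlsubmx x != 0 ->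
   exists2 x', red x x' & ulsubmx x' = 1%:M.
  move=> x0 /matrix0Pn[i [j c0]]; rewrite (ord1 j) in c0.
  (* The coefficient s solves u + s c = 1, with u the upper left entry and c a nonzero entry of the
     column below it. *)
  exists (block_mx 1%:M (((1 - ulsubmx x 0 0) / dlsubmx x i 0) *: delta_mx 0 i) 0 1%:M *m x).
    exact: redul.
  rewrite -[X in _ *m X]submxK mulmx_block block_mxKul mul1mx -scalemxAl -rowE.
  move: (ulsubmx x) (dlsubmx x) c0 => u c c0.
  by apply/matrixP => a b; rewrite !ord1 !mxE divfK // addrC subrK.
have step3 x : \det x != 0 -> exists2 x', red x x' &
   exists z, x' = block_mx 1%:M 0 0 z.
  move=> x0; have [x1 r1 c1] := step1 x x0.
  have [|x2 r2 u2] := step2 x1 _ c1; first by rewrite r1.1.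
  have x20 : \det x2 != 0 by rewrite r2.1 r1.1.
  have r3 := @redll x2 (- dlsubmx x2) x20.
  set x3 := _ *m x2 in r3.
  have x3E : x3 = block_mx 1%:M (ursubmx x2) 0 (- dlsubmx x2 *m ursubmx x2 + drsubmx x2).
    rewrite /x3 -[X in _ *m X = _]submxK mulmx_block u2 !mul1mx !mul0mx !addr0 mulmx1.
    by rewrite addNr.
  have x30 : \det x3 != 0 by rewrite r3.1.
  have r4 := @redur x3 (- ursubmx x2) x30.
  exists (x3 *m block_mx 1%:M (- ursubmx x2) 0 1%:M).
    by apply: (redt _ _ _ _ r4); apply: (redt _ _ _ _ r3); apply: (redt _ _ _ r1 r2).
  exists (- dlsubmx x2 *m ursubmx x2 + drsubmx x2).
  by rewrite x3E mulmx_block !mul1mx !mulmx1 !mul0mx !mulmx0 !add0r !addr0 addNr.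
have det1z (z : 'M[L]_d.+1) : \det (block_mx 1%:M 0 0 z : 'M[L]_(1 + d.+1)) = \det z.
  by rewrite det_ublock det1 mul1r.
have emb (N : 'M[L]_d.+1) : block_mx 1%:M 0 0 (1%:M + N)
    = 1%:M + block_mx 0 0 0 N :> 'M[L]_(1 + d.+1).
  by rewrite (scalar_mx_block 1 d.+1) add_block_mx !addr0.
have emb0 (N : 'M[L]_d.+1) : N *m N = 0 ->
    sq0 (block_mx 0 0 0 N : 'M[L]_(1 + d.+1)).
  by move=> NN; rewrite /sq0 mulmx_block !mulmx0 !mul0mx !addr0 NN add0r block_mx0.
move=> x y x0 xy.
have [x' [dx gx] [z zE]] := step3 x x0.
have [|y' [dy gy] [w wE]] := step3 y; first by rewrite -xy.
rewrite -gx -gy zE wE.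
pose g' (u : 'M[L]_d.+1) := g (block_mx 1%:M 0 0 u : 'M[L]_(1 + d.+1)).
apply: (IH g' _ _ z w).
- move=> N u NN u0; rewrite /g'.
  have -> : block_mx 1%:M 0 0 ((1%:M + N) *m u)
      = (1%:M + block_mx 0 0 0 N) *m block_mx 1%:M 0 0 u :> 'M[L]_(1 + d.+1).
    by rewrite -emb mulmx_block !mul1mx !mulmx0 !mul0mx !addr0 !add0r.
  by apply: gl; [apply: emb0 | rewrite det1z].
- move=> N u NN u0; rewrite /g'.
  have -> : block_mx 1%:M 0 0 (u *m (1%:M + N))
      = block_mx 1%:M 0 0 u *m (1%:M + block_mx 0 0 0 N) :> 'M[L]_(1 + d.+1).
    by rewrite -emb mulmx_block !mul1mx !mulmx0 !mul0mx !addr0 !add0r.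
  by apply: gr; [apply: emb0 | rewrite det1z].
- by rewrite -det1z -zE dx.
- by rewrite -!det1z -zE -wE dx dy.
Qed.

End Elementary.

(** * The reduced norm of a simple algebra *)

Section Coordinates.
Variables (F : fieldType) (A : falgType F).
Local Notation m := (\dim {:A}).

Lemma fcrdK (a : A) : a = \sum_i fcrd a i *: fbas i.
Proof.
rewrite {1}(coord_vbasis (memvf a)); apply: eq_bigr => i _.
by rewrite /fbas (tnth_nth 0).
Qed.

Lemma fcrd_is_linear (c : F) (a b : A) i : fcrd (c *: a + b) i = c * fcrd a i + fcrd b i.
Proof. by rewrite /fcrd linearP. Qed.

Lemma fcrd_fbas (i j : 'I_m) : fcrd (fbas i : A) j = (i == j)%:R.
Proof.
have fr : free (vbasis {:A}) by apply: basis_free (vbasisP _).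
by rewrite /fcrd /fbas (tnth_nth 0); apply: coord_free fr.
Qed.

Definition fvec (x : 'I_m -> F) : A := \sum_i x i *: fbas i.

Lemma fcrd_sum (I : finType) (x : I -> F) (b : I -> A) j :
  fcrd (\sum_i x i *: b i) j = \sum_i x i * fcrd (b i) j.
Proof.
by rewrite /fcrd linear_sum; apply: eq_bigr => i _; rewrite linearZ.
Qed.

Lemma fvecK (x : 'I_m -> F) i : fcrd (fvec x) i = x i.
Proof.
rewrite /fvec fcrd_sum (bigD1 i) //= fcrd_fbas eqxx mulr1 big1 ?addr0 // => j ji.
by rewrite fcrd_fbas (negbTE ji) mulr0.
Qed.

Lemma ext_of_linear (L : fieldType) (iota : {rmorphism F -> L}) (c : F) (a b : A) :
  ext_of iota (c *: a + b) = iota c *: ext_of iota a + ext_of iota b.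
Proof. by apply/rowP => i; rewrite !mxE fcrd_is_linear rmorphD rmorphM. Qed.

Lemma fcrdM (a b : A) k :
  fcrd (a * b) k = \sum_i \sum_j fcrd a i * fcrd b j * fcrd (fbas i * fbas j) k.
Proof.
rewrite {1}[a]fcrdK {1}[b]fcrdK mulr_suml.
rewrite (eq_bigr (fun i => fcrd a i *: (fbas i * \sum_j fcrd b j *: fbas j))).
  rewrite fcrd_sum; apply: eq_bigr => i _; rewrite mulr_sumr.
  rewrite (eq_bigr (fun j => fcrd b j *: (fbas i * fbas j))).
    by rewrite fcrd_sum mulr_sumr; apply: eq_bigr => j _; rewrite mulrA.
  by move=> j _; rewrite scalerAr.
by move=> i _; rewrite scalerAl.
Qed.

Lemma ext_ofM (L : fieldType) (iota : {rmorphism F -> L}) (a b : A) :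
  ext_of iota (a * b) = ext_mul iota (ext_of iota a) (ext_of iota b).
Proof.
apply/rowP => k; rewrite !mxE fcrdM rmorph_sum; apply: eq_bigr => i _.
by rewrite rmorph_sum; apply: eq_bigr => j _; rewrite !mxE !rmorphM.
Qed.

End Coordinates.

Section Split.
Variables (F : fieldType) (infF : forall s : seq F, exists x : F, x \notin s).
Variables (A : falgType F) (L : closedFieldType) (iota : {rmorphism F -> L}).
Local Notation m := (\dim {:A}).
Variables (h d : nat) (psi : 'rV[L]_m -> 'I_h -> 'M[L]_d.+1).
Hypothesis psi_lin : forall (c : L) v w k, psi (c *: v + w) k = c *: psi v k + psi w k.
Hypothesis psi_inj : forall v w, (forall k, psi v k = psi w k) -> v = w.
Hypothesis psi_surj : forall y : 'I_h -> 'M[L]_d.+1, exists v, forall k, psi v k = y k.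
Hypothesis psi_mul : forall v w k, psi (ext_mul iota v w) k = psi v k *m psi w k.
Hypothesis psi_one : forall k, psi (ext_one A iota) k = 1%:M.

Lemma psi0 k : psi 0 k = 0.
Proof.
have := psi_lin 1 0 0 k; rewrite !scale1r addr0 => /eqP.
by rewrite -{1}[psi 0 k]addr0 (inj_eq (addrI _)) eq_sym => /eqP.
Qed.

Lemma psiD v w k : psi (v + w) k = psi v k + psi w k.
Proof. by rewrite -[v in LHS]scale1r psi_lin scale1r. Qed.

Lemma psiZ c v k : psi (c *: v) k = c *: psi v k.
Proof. by rewrite -[c *: v in LHS]addr0 psi_lin psi0 addr0. Qed.

Lemma psi_sum (I : Type) (r : seq I) (P : pred I) (f : I -> 'rV[L]_m) k :
  psi (\sum_(i <- r | P i) f i) k = \sum_(i <- r | P i) psi (f i) k.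
Proof.
by apply: (big_morph (psi^~ k)) => [v w|]; rewrite ?psi0 ?psiD.
Qed.

Definition is_unit v := forall k, \det (psi v k) != 0.

(* The k-th component of the generic element of L (x) A. *)
Definition gmat k : 'M[{mpoly L[m]}]_d.+1 :=
  \sum_i 'X_i *: map_mx (@mpolyC m L) (psi (delta_mx 0 i) k).

Lemma gmatE (v : 'rV[L]_m) k : map_mx (meval (v 0)) (gmat k) = psi v k.
Proof.
rewrite /gmat (map_mx_sum (meval (v 0))) /= [in RHS](row_sum_delta v) psi_sum.
apply: eq_bigr => i _; rewrite psiZ; apply/matrixP => a b.
by rewrite !mxE mevalM mevalC mevalXU.
Qed.

Lemma gdetE (v : 'rV[L]_m) k : (\det (gmat k)).@[v 0] = \det (psi v k).
Proof. by rewrite -gmatE det_map_mx. Qed.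

(** Preimages are chosen for the matrix units only and extended linearly, so finite choice
    suffices. *)
Lemma psi_inverse : exists phi : ('I_h -> 'M[L]_d.+1) -> 'rV[L]_m,
  forall y k, psi (phi y) k = y k.
Proof.
have [|E HE] := fin_all_exists (P := fun (p : 'I_h * ('I_d.+1 * 'I_d.+1)) v =>
   forall k, psi v k = if k == p.1 then delta_mx p.2.1 p.2.2 else 0).
  by move=> p; apply: (psi_surj (fun k => if k == p.1 then delta_mx p.2.1 p.2.2 else 0)).
exists (fun y => \sum_k \sum_i \sum_j y k i j *: E (k, (i, j))) => y k.
rewrite psi_sum (bigD1 k) //= [X in _ + X]big1 ?addr0 => [|k' kk']; last first.
  rewrite psi_sum big1 // => i _; rewrite psi_sum big1 // => j _.
  by rewrite psiZ HE /= eq_sym (negbTE kk') scaler0.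
rewrite [RHS]matrix_sum_delta psi_sum; apply: eq_bigr => i _.
by rewrite psi_sum; apply: eq_bigr => j _; rewrite psiZ HE eqxx.
Qed.

Lemma meval_line (P : {mpoly L[m]}) (v w : 'rV[L]_m) :
  exists p : {poly L}, forall t, p.[t] = P.@[(v + t *: w) 0].
Proof.
exists (mmap polyC (fun i => (v 0 i)%:P + w 0 i *: 'X) P) => t.
rewrite -horner_evalE rmorph_mmap; apply: eq_mmap => [c|i] /=.
  by rewrite horner_evalE hornerC.
by rewrite horner_evalE !mxE hornerD hornerC hornerZ hornerX mulrC.
Qed.

Section Nonvanishing.
Variables (P : {mpoly L[m]}) (Punit : forall v : 'rV[L]_m, is_unit v -> P.@[v 0] != 0).

Lemma det_unipotent n (N : 'M[L]_n) t : N *m N = 0 -> \det (1%:M + t *: N) != 0.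
Proof.
move=> NN; suff: (1%:M + t *: N) *m (1%:M - t *: N) = 1%:M.
  by move=> /mulmx1_unit[]; rewrite unitmxE unitfE.
rewrite mulmxDl mul1mx mulmxBr mulmx1 -scalemxAl -scalemxAr NN !scaler0 subr0.
by rewrite subrK.
Qed.

(** The line through [v] and [w] consists of units, since det (1 + t N) is nonzero when N^2 = 0; a
    polynomial without zeros on a line is constant there. *)
Lemma unipotent_invariant (N : 'I_h -> 'M[L]_d.+1) v w :
  (forall k, N k *m N k = 0) -> is_unit v ->
  (forall k, psi w k = (1%:M + N k) *m psi v k) \/
  (forall k, psi w k = psi v k *m (1%:M + N k)) -> P.@[w 0] = P.@[v 0].
Proof.
move=> NN vu H.
have [n [nE nu]] : exists n, w = v + n /\ forall t, is_unit (v + t *: n).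
  case: H => H.
    have [n nE] := psi_surj (fun k => N k *m psi v k); exists n; split.
      by apply: psi_inj => k; rewrite psiD nE H mulmxDl mul1mx.
    move=> t k; rewrite psiD psiZ nE scalemxAl -{1}[psi v k]mul1mx -mulmxDl.
    by rewrite det_mulmx mulf_neq0 // det_unipotent.
  have [n nE] := psi_surj (fun k => psi v k *m N k); exists n; split.
    by apply: psi_inj => k; rewrite psiD nE H mulmxDr mulmx1.
  move=> t k; rewrite psiD psiZ nE scalemxAr -{1}[psi v k]mulmx1 -mulmxDr.
  by rewrite det_mulmx mulf_neq0 // det_unipotent.
have [p pE] := meval_line P v n.
have := pE 1; have := pE 0; rewrite nE scale1r scale0r addr0 => <- <-.
by apply: nonvanishing_const => t; rewrite pE Punit.
Qed.

Lemma nonvanishing_det v w : is_unit v ->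
  (forall k, \det (psi v k) = \det (psi w k)) -> P.@[v 0] = P.@[w 0].
Proof.
move=> vu vw; have [phi phiE] := psi_inverse.
(* Induction on the number [j] of leading components in which [u] may still differ from [w]. *)
suff: forall j u, is_unit u -> (forall k, \det (psi u k) = \det (psi w k)) ->
    (forall k : 'I_h, (j <= k)%N -> psi u k = psi w k) -> P.@[u 0] = P.@[w 0].
  by move/(_ h v vu vw); apply => k; rewrite leqNgt ltn_ord.
elim=> [|j IH] u uu uw ujw.
  by have -> : u = w by apply: psi_inj => k; apply: ujw.
have [jh|jh] := ltnP j h; last first.
  by apply: IH => // k jk; move: (leq_trans jh jk); rewrite leqNgt ltn_ord.
pose k0 := Ordinal jh.
pose y z k := if k == k0 then z else psi u k.
have unity z : \det z != 0 -> is_unit (phi (y z)).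
  by move=> z0 k; rewrite phiE /y; case: ifP.
have yu : phi (y (psi u k0)) = u.
  by apply: psi_inj => k; rewrite phiE /y; case: eqP => [->|].
pose N M k : 'M[L]_d.+1 := if k == k0 then M else 0.
have -> : P.@[u 0] = P.@[phi (y (psi w k0)) 0].
  rewrite -{1}yu; apply: (@det_invariant _ _ _ (fun z => P.@[phi (y z) 0])) => //.
  - move=> M x MM x0; apply: (@unipotent_invariant (N M)).
    + by move=> k; rewrite /N; case: ifP; rewrite ?mulmx0.
    + exact: unity.
    + by left=> k; rewrite !phiE /y /N; case: ifP; rewrite ?addr0 ?mul1mx.
  - move=> M x MM x0; apply: (@unipotent_invariant (N M)).
    + by move=> k; rewrite /N; case: ifP; rewrite ?mulmx0.
    + exact: unity.
    + by right=> k; rewrite !phiE /y /N; case: ifP; rewrite ?addr0 ?mulmx1.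
apply: IH => [|k|k jk].
- by apply: unity; rewrite -uw.
- by rewrite phiE /y; case: eqP => [->|].
- rewrite phiE /y; case: eqP => [-> //|/eqP nk]; apply: ujw.
  by rewrite ltn_neqAle jk andbT eq_sym.
Qed.

Lemma gdet_neq0 : \prod_k \det (gmat k) != 0.
Proof.
apply/prodf_neq0 => k _; apply: contraTneq isT => e.
have := gdetE (ext_one A iota) k; rewrite e meval0 psi_one det1 => /eqP.
by rewrite eq_sym oner_eq0.
Qed.

(** The units are the nonvanishing locus of a nonzero polynomial, hence dense over the infinite
    field [L]. *)
Lemma mpoly_eq_on_units (P1 P2 : {mpoly L[m]}) :
  (forall v : 'rV[L]_m, is_unit v -> P1.@[v 0] = P2.@[v 0]) -> P1 = P2.
Proof.
move=> H; apply/eqP; rewrite -subr_eq0; apply: contraT => n0.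
have [a] := mpoly_denseF_neq (@closed_field_infinite L) (mulf_neq0 n0 gdet_neq0).
rewrite mevalM mulf_eq0 negb_or rmorph_prod mevalB => /andP[ne /prodf_neq0 u].
have aE : a =1 (\row_i a i) 0 by move=> i; rewrite mxE.
rewrite !(meval_eq _ aE) H ?subrr ?eqxx // in ne => k.
by rewrite -gdetE -(meval_eq _ aE); apply: u.
Qed.

(* On units P only depends on the determinants, and as a function of these it is
   a polynomial without zeros on the torus, that is a monomial. *)
Lemma nonvanishing_prod_det :
  exists c (e : 'I_h -> nat), P = c *: \prod_k \det (gmat k) ^+ e k.
Proof.
have [phi phiE] := psi_inverse.
(* [D delta] is affine in [delta] and has k-th component diag(delta k, 1, ..., 1), so it realizes
   every tuple of determinants. *)
pose y0 (k : 'I_h) : 'M[L]_d.+1 := 1%:M - delta_mx 0 0.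
pose y1 (j k : 'I_h) : 'M[L]_d.+1 := if k == j then delta_mx 0 0 else 0.
pose D (delta : 'I_h -> L) := phi y0 + \sum_j delta j *: phi (y1 j).
have DE delta k : \det (psi (D delta) k) = delta k.
  rewrite psiD psi_sum phiE (bigD1 k) //= psiZ phiE {1}/y1 eqxx big1 ?addr0; last first.
    by move=> j jk; rewrite psiZ phiE /y1 eq_sym (negbTE jk) scaler0.
  have -> : y0 k + delta k *: delta_mx 0 0
     = diag_mx (\row_i if i == 0 then delta k else 1).
    apply/matrixP => i j; rewrite !mxE.
    have [->|ij] := eqVneq i j.
      by case: (eqVneq j 0) => _ /=; rewrite ?subrr ?add0r ?mulr1 // subr0 mulr0 addr0.
    case: (eqVneq i 0) => [i0|_] /=; rewrite ?subr0 ?mulr0 ?addr0 //.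
    case: (eqVneq j 0) => [j0|_] /=; rewrite ?subr0 ?mulr0 ?addr0 //.
    by rewrite i0 j0 eqxx in ij.
  rewrite det_diag big_ord_recl mxE eqxx big1 ?mulr1 // => i _.
  by rewrite mxE.
pose q : {mpoly L[h]} := mmap (@mpolyC h L)
  (fun l => (phi y0 0 l)%:MP + \sum_j phi (y1 j) 0 l *: 'X_j) P.
have qE delta : q.@[delta] = P.@[D delta 0].
  rewrite {1}/meval rmorph_mmap; apply: eq_mmap => [c|l] /=.
    by rewrite -/(meval _ _) mevalC.
  rewrite -/(meval _ _) mevalD mevalC raddf_sum /D mxE summxE; congr (_ + _).
  by apply: eq_bigr => j _; rewrite !mxE /= mevalZ mevalXU mulrC.
have [|c [e qe]] := @nonvanishing_mmonomial L h q.
  by move=> delta d0; rewrite qE Punit // => k; rewrite DE.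
exists c, e; apply: mpoly_eq_on_units => v vu.
rewrite (@nonvanishing_det v (D (fun k => \det (psi v k)))) //; last first.
  by move=> k; rewrite DE.
rewrite -qE qe !mevalZ mevalX rmorph_prod; congr (_ * _).
by apply: eq_bigr => k _; rewrite rmorphXn /= gdetE.
Qed.

End Nonvanishing.

Definition sigma k (a : A) := psi (ext_of iota a) k.

Lemma sigma_lin k (c : F) a b : sigma k (c *: a + b) = iota c *: sigma k a + sigma k b.
Proof. by rewrite /sigma ext_of_linear psi_lin. Qed.

Lemma sigma0 k : sigma k 0 = 0.
Proof.
rewrite /sigma -[RHS](psi0 k); congr psi; apply/rowP => i.
by rewrite !mxE /fcrd linear0 rmorph0.
Qed.

Lemma sigmaD k a b : sigma k (a + b) = sigma k a + sigma k b.
Proof. by rewrite -[a in LHS]scale1r sigma_lin rmorph1 scale1r. Qed.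

Lemma sigmaZ k c a : sigma k (c *: a) = iota c *: sigma k a.
Proof. by rewrite -[c *: a in LHS]addr0 sigma_lin sigma0 addr0. Qed.

Lemma sigmaM k a b : sigma k (a * b) = sigma k a *m sigma k b.
Proof. by rewrite /sigma ext_ofM psi_mul. Qed.

Lemma sigma1 k : sigma k 1 = 1%:M.
Proof. exact: psi_one. Qed.

Lemma sigma_horner k a p : sigma k (horner_alg a p) = horner_mx (sigma k a) (map_poly iota p).
Proof.
elim/poly_ind: p => [|p c IH]; first by rewrite !rmorph0 sigma0.
rewrite !rmorphD !rmorphM /= map_polyX map_polyC /= horner_mx_X horner_mx_C.
rewrite horner_algX horner_algC sigmaD sigmaM IH sigmaZ sigma1.
by rewrite scalemx1.
Qed.

Hypothesis Asimple : simple_alg A.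

Lemma sigma_prodv0 k (U V : {vspace A}) :
  (forall u v, u \in U -> v \in V -> sigma k (u * v) = 0) ->
  forall w, w \in (U * V)%VS -> sigma k w = 0.
Proof.
move=> H w; rewrite [@prodv _ _]unlock; set X := allpairs _ _ _ => wX.
rewrite (@coord_span _ _ _ (in_tuple X) w wX) (big_morph (sigma k) (sigmaD k) (sigma0 k)).
rewrite big1 // => i _; rewrite sigmaZ.
have /allpairsP[[u v] /= [Uu Vv ->]] : (in_tuple X)`_i \in X by apply: mem_nth.
by rewrite H ?scaler0 ?vbasis_mem.
Qed.

(** The ideal A a A is killed by [sigma k]; were it all of [A], then 1 would go to 0. By simplicity
    it is zero, and it contains [a]. *)
Lemma sigma_inj k a : sigma k a = 0 -> a = 0.
Proof.
move=> a0; pose I := (fullv * <[a]> * fullv)%VS.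
have fullM (U : {vspace A}) : (fullv * (fullv * U) <= fullv * U)%VS.
  by rewrite prodvA prodvSl ?subvf.
have I2 : two_sided_ideal I.
  move=> x y b bI; have : x * b * y \in (fullv * I * fullv)%VS.
    by rewrite !memv_mul ?memvf.
  apply/subvP: (x * b * y); rewrite /I -!prodvA.
  apply: (subv_trans (prodvSr _ _)); last exact: fullM.
  apply: prodvSr; apply: prodvSr; exact: subvf.
have aI : a \in I.
  by rewrite -[a]mulr1 -[a]mul1r !memv_mul ?memvf ?memv_line.
have [I0|I1] := Asimple I2; first by apply/eqP; rewrite -memv0 -I0.
have : sigma k 1 = 0.
  apply: (@sigma_prodv0 k (fullv * <[a]>)%VS fullv); last by rewrite -/I I1 memvf.
  move=> u v uU _; rewrite sigmaM (@sigma_prodv0 k fullv <[a]>%VS _ u) ?mul0mx //.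
  by move=> x _ _ /vlineP[c ->]; rewrite sigmaM sigmaZ a0 scaler0 mulmx0.
by rewrite sigma1 => /matrixP/(_ 0 0)/eqP; rewrite !mxE eqxx oner_eq0.
Qed.

Lemma char_poly_horner n (M : 'M[L]_n) t : (char_poly M).[t] = \det (t%:M - M).
Proof.
rewrite /char_poly -horner_evalE -det_map_mx; congr (\det _).
apply/matrixP => i j; rewrite !mxE /= horner_evalE hornerD hornerN hornerC.
by case: eqP => _; rewrite ?hornerX ?mulr1n // mulr0n horner0.
Qed.

Lemma meval_ext_of (P : {mpoly F[m]}) a :
  (map_mpoly iota P).@[ext_of iota a 0] = iota P.@[fcrd a].
Proof.
rewrite meval_map_mpoly /meval rmorph_mmap; apply: eq_mmap => // i /=.
by rewrite mxE.
Qed.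

Section DetProduct.
Variables (P : {mpoly F[m]}) (c : L) (e : 'I_h -> nat).
Hypothesis PE : map_mpoly iota P = c *: \prod_k \det (gmat k) ^+ e k.

Lemma meval_detprod (v : 'rV[L]_m) : (map_mpoly iota P).@[v 0] = c * \prod_k \det (psi v k) ^+ e k.
Proof.
rewrite PE mevalZ rmorph_prod; congr (_ * _); apply: eq_bigr => k _.
by rewrite rmorphXn /= gdetE.
Qed.

(** The polynomial is P(t - a): it has coefficients in [F] as [P] does, and over [L] each
    determinant of t - a is a characteristic polynomial. *)
Lemma detprod_char a : exists2 p : {poly F},
  forall t, p.[t] = P.@[fcrd (t%:A - a)] &
  map_poly iota p = c *: \prod_k char_poly (sigma k a) ^+ e k.
Proof.
pose w i : {poly F} := fcrd (1 : A) i *: 'X - (fcrd a i)%:P.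
exists (mmap polyC w P) => [t|].
  rewrite -horner_evalE rmorph_mmap; apply: eq_mmap => [x|i] /=.
    by rewrite horner_evalE hornerC.
  rewrite horner_evalE /w hornerD hornerN hornerC hornerZ hornerX.
  by rewrite fcrd_is_linear mulrC /fcrd linearN.
apply/eqP; rewrite -subr_eq0; apply/eqP.
apply: (poly_dense (@closed_field_infinite L) (iota := idfun)) => t.
rewrite hornerD hornerN hornerZ horner_prod.
have -> : \prod_k (char_poly (sigma k a) ^+ e k).[t]
    = \prod_k \det (psi (t *: ext_one A iota - ext_of iota a) k) ^+ e k.
  apply: eq_bigr => k _; rewrite horner_exp char_poly_horner; congr (\det _ ^+ _).
  by rewrite addrC -[- _ in RHS]scaleN1r psi_lin psiZ psi_one scalemx1 scaleN1r addrC.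
apply/eqP; rewrite subr_eq0 -meval_detprod; apply/eqP.
rewrite meval_map_mpoly -horner_evalE.
rewrite rmorph_mmap rmorph_mmap; apply: eq_mmap => [x|i] /=.
  by rewrite horner_evalE map_polyC hornerC.
rewrite horner_evalE /w rmorphB /= map_polyZ map_polyX map_polyC /=.
by rewrite hornerD hornerN hornerC hornerZ hornerX !mxE mulrC.
Qed.

Hypothesis c0 : c != 0.

(* P(t - a) kills a by Cayley-Hamilton and simplicity, so over L the polynomial
   prod_k char_poly (psi v k) ^+ e k kills every psi v j; now let v be 0 in the
   components with e k > 0 and 1 in the others. *)
Lemma detprod_exponents k0 : (0 < e k0)%N -> forall j, (0 < e j)%N.
Proof.
move=> ek0 j; rewrite lt0n; apply/eqP => ej.
pose D := \prod_k char_poly (gmat k) ^+ e k.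
have DE (v : 'rV[L]_m) : map_mx (meval (v 0)) (horner_mx (gmat j) D)
    = horner_mx (psi v j) (\prod_k char_poly (psi v k) ^+ e k).
  rewrite map_horner_mx gmatE rmorph_prod; congr (horner_mx _ _).
  by apply: eq_bigr => k _; rewrite rmorphXn /= map_char_poly gmatE.
(* By density it suffices to specialize to elements [b] of [A], where Cayley-Hamilton in component
   [k0] and [sigma_inj] apply. *)
have D0 : horner_mx (gmat j) D = 0.
  apply/matrixP => x y; rewrite [RHS]mxE; apply: (mpoly_dense infF (iota := iota)) => a.
  pose b := fvec a.
  have -> : (horner_mx (gmat j) D x y).@[iota \o a]
     = map_mx (meval (ext_of iota b 0)) (horner_mx (gmat j) D) x y.
    rewrite [RHS]mxE; apply: meval_eq => i; by rewrite !mxE fvecK.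
  rewrite DE; have [p _ pE] := detprod_char b.
  have pb : horner_alg b p = 0.
    apply: (@sigma_inj k0); rewrite sigma_horner pE linearZ /= (bigD1 k0) //=.
    rewrite -(prednK ek0) exprS -!mulrA rmorphM /= Cayley_Hamilton mul0r.
    by rewrite scaler0.
  have := sigma_horner j b p; rewrite pb sigma0 pE linearZ /= => /esym/eqP.
  by rewrite scaler_eq0 (negbTE c0) => /eqP -> ; rewrite mxE.
have [v vE] := psi_surj (fun k => if (e k == 0)%N then 1%:M else 0).
have := DE v; rewrite D0 map_mx0 vE ej eqxx.
(* The product becomes a power of X; its value at the [j]-th component, which is 1, is 1 and not
   0. *)
have charX k : char_poly (psi v k) ^+ e k = 'X^(d.+1 * e k).
  rewrite vE; case: eqP => [->|_]; first by rewrite muln0 !expr0.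
  have -> : char_poly (0 : 'M[L]_d.+1) = 'X^(d.+1).
    by rewrite /char_poly /char_poly_mx map_mx0 subr0 det_scalar.
  by rewrite -exprM.
rewrite (eq_bigr _ (fun k _ => charX k)) rmorph_prod big1 => [|k _].
  by move=> /matrixP/(_ 0 0)/eqP; rewrite !mxE eqxx eq_sym oner_eq0.
by rewrite rmorphXn /= horner_mx_X expr1n.
Qed.

End DetProduct.

Variable N : A -> F.
Hypothesis NE : forall a, iota (N a) = \prod_(k < h) \det (psi (ext_of iota a) k).

(** At [F]-points the product of determinants equals [N], which takes values in [F], so it
    descends. *)
Lemma redpoly_exists : exists N0 : {mpoly F[m]},
  map_mpoly iota N0 = \prod_k \det (gmat k).
Proof.
have [a _|N0 ->] := @mpoly_descend _ infF _ iota m 1 (oner_neq0 _) (\prod_k \det (gmat k)).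
  exists (N (fvec a)); rewrite NE rmorph_prod; apply: eq_bigr => k _.
  rewrite -gdetE; apply: meval_eq => i; by rewrite mxE fvecK.
by exists N0.
Qed.

Section Redpoly.
Variables (N0 : {mpoly F[m]}) (N0E : map_mpoly iota N0 = \prod_k \det (gmat k)).

Lemma redpoly_rep a : N a = N0.@[fcrd a].
Proof.
apply: (fmorph_inj iota); rewrite NE -meval_ext_of N0E rmorph_prod.
by apply: eq_bigr => k _; rewrite -gdetE.
Qed.

Lemma mconst_map (P : {mpoly F[m]}) (c : L) : map_mpoly iota P = c%:MP -> mconst P.
Proof.
move=> Pc; suff -> : P = (mcoeff 0%MM P)%:MP by rewrite /mconst msizeC; case: (_ != 0).
apply: (@map_mpoly_inj _ _ _ iota); rewrite map_mpolyC -(mcoeff_map_mpoly iota) Pc.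
by rewrite mcoeffC eqxx mulr1.
Qed.

Lemma detprod_mconst (P : {mpoly F[m]}) c e :
  map_mpoly iota P = c *: \prod_k \det (gmat k) ^+ e k ->
  ~~ mconst P -> c != 0 /\ exists k, (0 < e k)%N.
Proof.
move=> PE Pn; split.
  by apply: contraNneq Pn => c0; apply: (@mconst_map _ 0); rewrite PE c0 scale0r mpolyC0.
apply: NNPP => H; case/negP: Pn; apply: (@mconst_map _ c); rewrite PE big1.
  by rewrite -[c *: 1]/(c%:A) alg_mpolyC.
move=> k _; case: (posnP (e k)) => [->|ek]; first by rewrite expr0.
by case: H; exists k.
Qed.

Lemma h_gt0 : (0 < h)%N.
Proof.
rewrite lt0n; apply/eqP => h0.
have e : (ext_of iota (1 : A)) = ext_of iota 0.
  by apply: psi_inj => -[k kh]; exfalso; rewrite h0 in kh.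
have : (1 : A) = 0.
  rewrite [LHS]fcrdK [RHS]fcrdK; apply: eq_bigr => i _; congr (_ *: _).
  by have := congr1 (fun v : 'rV_m => v 0 i) e; rewrite !mxE => /fmorph_inj.
by move/eqP; rewrite oner_eq0.
Qed.

(** Both factors have no zeros on units, so they are products of powers of the determinants. If
    neither is constant, every determinant occurs in both, hence at least twice in the product. *)
Lemma redpoly_irreducible (Q1 Q2 : {mpoly F[m]}) : N0 = Q1 * Q2 -> mconst Q1 \/ mconst Q2.
Proof.
move=> NQ.
have NQi : map_mpoly iota Q1 * map_mpoly iota Q2 = \prod_k \det (gmat k).
  by rewrite -N0E NQ rmorphM.
have unit (v : 'rV[L]_m) : is_unit v ->
   (map_mpoly iota Q1).@[v 0] * (map_mpoly iota Q2).@[v 0] != 0.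
  move=> vu; rewrite -mevalM NQi rmorph_prod.
  by apply/prodf_neq0 => k _; rewrite /= gdetE.
have [|c1 [e1 E1]] := @nonvanishing_prod_det (map_mpoly iota Q1).
  by move=> v /unit; rewrite mulf_eq0 negb_or => /andP[].
have [|c2 [e2 E2]] := @nonvanishing_prod_det (map_mpoly iota Q2).
  by move=> v /unit; rewrite mulf_eq0 negb_or => /andP[].
apply: NNPP => /not_or_and[/negP n1 /negP n2].
have [c10 [k1 k1e]] := detprod_mconst E1 n1.
have [c20 [k2 k2e]] := detprod_mconst E2 n2.
have e1p := detprod_exponents E1 c10 k1e.
have e2p := detprod_exponents E2 c20 k2e.
pose k0 := Ordinal h_gt0.
(* An element with determinants t, 1, ..., 1 isolates the exponent at [k0]. *)
have D1 (t : L) : exists v, forall k, \det (psi v k) = if k == k0 then t else 1.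
  have [v vE] := psi_surj (fun k => if k == k0 then
       diag_mx (\row_(i < d.+1) if i == 0 then t else 1) else 1%:M).
  exists v => k; rewrite vE; case: eqP => _; last by rewrite det1.
  rewrite det_diag big_ord_recl mxE eqxx big1 ?mulr1 // => i _.
  by rewrite mxE.
have Dt t : t = c1 * c2 * t ^+ (e1 k0 + e2 k0).
  have [v vE] := D1 t.
  have prodv e : \prod_k \det (psi v k) ^+ e k = t ^+ e k0.
    rewrite (bigD1 k0) //= vE eqxx big1 ?mulr1 // => k kk.
    by rewrite vE (negbTE kk) expr1n.
  have := congr1 (meval (v 0)) NQi.
  rewrite mevalM (meval_detprod E1) (meval_detprod E2) !prodv rmorph_prod /=.
  rewrite (eq_bigr (fun k => \det (psi v k) ^+ 1)) => [|k _]; last by rewrite gdetE.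
  by rewrite (prodv (fun=> 1%N)) expr1 exprD mulrACA => ->.
have : 'X = (c1 * c2) *: 'X^(e1 k0 + e2 k0) :> {poly L}.
  apply/eqP; rewrite -subr_eq0; apply/eqP.
  apply: (poly_dense (@closed_field_infinite L) (iota := idfun)) => t.
  by rewrite hornerD hornerN hornerZ hornerX hornerXn -Dt subrr.
move/(congr1 (fun p : {poly L} => p`_1)); rewrite coefX coefZ coefXn eqxx.
case: eqP => [e|_]; last by rewrite mulr0 => /eqP; rewrite oner_eq0.
have := leq_add (e1p k0) (e2p k0); by rewrite -e.
Qed.

(* A multiplicative polynomial is nonvanishing on units, hence a product of powers
   of the determinants, in which all exponents are positive. *)
Lemma redpoly_dvd (f : A -> F) (P : {mpoly F[m]}) :
  (forall a, f a = P.@[fcrd a]) -> multiplicative_fun f -> f 1 = 1 -> ~~ mconst P ->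
  exists G, P = N0 * G.
Proof.
move=> fP fM f1 Pn.
pose PL := map_mpoly iota P.
have fL a : PL.@[ext_of iota a 0] = iota (f a) by rewrite meval_ext_of fP.
(* Multiplicativity extends to scalars in [L] one argument at a time: [T] is the difference of the
   two sides as a polynomial in the free argument, and it vanishes at elements of [A]. *)
have PM1 (a : A) (w : 'rV[L]_m) : PL.@[ext_mul iota (ext_of iota a) w 0] = PL.@[ext_of iota a 0] * PL.@[w 0].
  pose lin k : {mpoly L[m]} := \sum_i \sum_i'
     (ext_of iota a 0 i * iota (fcrd (fbas i * fbas i') k)) *: 'X_i'.
  pose T := mmap (@mpolyC m L) lin PL - PL.@[ext_of iota a 0] *: PL.
  have TE (u : 'rV[L]_m) : T.@[u 0] = PL.@[ext_mul iota (ext_of iota a) u 0] - PL.@[ext_of iota a 0] * PL.@[u 0].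
    rewrite mevalB mevalZ; congr (_ - _); rewrite /meval rmorph_mmap.
    apply: eq_mmap => [x|k] /=; first by rewrite -/(meval _ _) mevalC.
    rewrite -/(meval _ _) !mxE raddf_sum; apply: eq_bigr => i _.
    rewrite raddf_sum; apply: eq_bigr => i' _.
    by rewrite /= mevalZ mevalXU mulrAC.
  have T0 : T = 0.
    apply: (mpoly_dense infF (iota := iota)) => b.
    have bE : iota \o b =1 ext_of iota (fvec b) 0 by move=> i; rewrite mxE fvecK.
    by rewrite (meval_eq _ bE) TE -ext_ofM !fL fM rmorphM subrr.
  by apply/eqP; rewrite -subr_eq0 -TE T0 meval0.
have PM (v w : 'rV[L]_m) : PL.@[ext_mul iota v w 0] = PL.@[v 0] * PL.@[w 0].
  pose lin k : {mpoly L[m]} := \sum_i \sum_i'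
     (w 0 i' * iota (fcrd (fbas i * fbas i') k)) *: 'X_i.
  pose T := mmap (@mpolyC m L) lin PL - PL.@[w 0] *: PL.
  have TE (u : 'rV[L]_m) : T.@[u 0] = PL.@[ext_mul iota u w 0] - PL.@[u 0] * PL.@[w 0].
    rewrite mevalB mevalZ [_.@[w 0] * _]mulrC; congr (_ - _); rewrite /meval rmorph_mmap.
    apply: eq_mmap => [x|k] /=; first by rewrite -/(meval _ _) mevalC.
    rewrite -/(meval _ _) !mxE raddf_sum; apply: eq_bigr => i _.
    rewrite raddf_sum; apply: eq_bigr => i' _.
    by rewrite /= mevalZ mevalXU mulrC mulrA.
  have T0 : T = 0.
    apply: (mpoly_dense infF (iota := iota)) => b.
    have bE : iota \o b =1 ext_of iota (fvec b) 0 by move=> i; rewrite mxE fvecK.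
    by rewrite (meval_eq _ bE) TE PM1 subrr.
  by apply/eqP; rewrite -subr_eq0 -TE T0 meval0.
have PL1 : PL.@[ext_one A iota 0] = 1.
  by have := fL 1; rewrite f1 rmorph1.
have [|c [e PE]] := @nonvanishing_prod_det PL.
  move=> v vu; have [w wE] := psi_surj (fun k => invmx (psi v k)).
  have vw : ext_mul iota v w = ext_one A iota.
    by apply: psi_inj => k; rewrite psi_mul psi_one wE mulmxV // unitmxE unitfE.
  have := PM v w; rewrite vw PL1 => e; apply/eqP => z.
  by move/eqP: e; rewrite z mul0r oner_eq0.
have [c0 [k0 ek0]] := detprod_mconst PE Pn.
have ep := detprod_exponents PE c0 ek0.
pose GL := c *: \prod_k \det (gmat k) ^+ (e k).-1.
have PG : PL = map_mpoly iota N0 * GL.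
  rewrite PE /GL -scalerAr N0E -big_split /=; congr (_ *: _).
  by apply: eq_bigr => k _; rewrite -exprS prednK.
have N0n : N0 != 0.
  apply: contraTneq (gdet_neq0) => N00.
  by rewrite -N0E N00 rmorph0 eqxx.
(* Where [N] is nonzero, the value of [GL] at an [F]-point is the quotient of [f] by [N], which lies
   in [F]. *)
have [a Na|G GE] := @mpoly_descend _ infF _ iota m N0 N0n GL.
  have aE : iota \o a =1 ext_of iota (fvec a) 0 by move=> i; rewrite mxE fvecK.
  exists (f (fvec a) / N (fvec a)); rewrite (meval_eq _ aE) rmorphM fmorphV -fL PG mevalM.
  have -> : (map_mpoly iota N0).@[ext_of iota (fvec a) 0] = iota (N (fvec a)).
    by rewrite meval_ext_of redpoly_rep.
  rewrite mulrC mulKf // fmorph_eq0 redpoly_rep.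
  have aE' : a =1 fcrd (fvec a) by move=> i; rewrite fvecK.
  by rewrite -(meval_eq _ aE').
exists G; apply: (@map_mpoly_inj _ _ _ iota).
by rewrite rmorphM /= -GE -PG.
Qed.

Lemma reduced_normM : multiplicative_fun N.
Proof.
move=> a b; apply: (fmorph_inj iota); rewrite rmorphM !NE -big_split.
by apply: eq_bigr => k _; rewrite -/(sigma k _) sigmaM det_mulmx.
Qed.

Lemma reduced_norm_scalar t : N t%:A = t ^+ (h * d.+1).
Proof.
apply: (fmorph_inj iota); rewrite NE rmorphXn /=.
rewrite (eq_bigr (fun=> iota t ^+ d.+1)) => [|k _].
  by rewrite prodr_const card_ord -exprM mulnC.
by rewrite -/(sigma k _) sigmaZ sigma1 scalemx1 det_scalar.
Qed.

Lemma reduced_char_poly a : exists p : {poly F},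
  [/\ p \is monic, size p = (h * d.+1).+1, forall t, p.[t] = N (t%:A - a)
    & horner_alg a p = 0].
Proof.
have N0E' : map_mpoly iota N0 = 1 *: \prod_k \det (gmat k) ^+ 1.
  by rewrite scale1r N0E; apply: eq_bigr.
have [p pt pE] := detprod_char (e := fun=> 1%N) N0E' a.
have pm : map_poly iota p = \prod_k char_poly (sigma k a).
  by rewrite pE scale1r; apply: eq_bigr => k _.
have pmonic : map_poly iota p \is monic.
  by rewrite pm monic_prod // => k _; apply: char_poly_monic.
exists p; split.
- by rewrite map_monic in pmonic.
- rewrite -(size_map_poly iota) pm size_prod => [|k _]; last first.
    exact: monic_neq0 (char_poly_monic _).
  rewrite (eq_bigr (fun=> d.+2)) => [|k _]; last by rewrite size_char_poly.
  rewrite sum_nat_const cardE size_enum_ord.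
  by rewrite mulnS -addnS addnC addnK mulnC.
- by move=> t; rewrite pt redpoly_rep.
- apply: (@sigma_inj (Ordinal h_gt0)); rewrite sigma_horner pm (bigD1 (Ordinal h_gt0)) //=.
  by rewrite rmorphM /= Cayley_Hamilton mul0r.
Qed.

(** * Elements whose minimal polynomial has the degree of the norm *)

Local Notation T := ('I_h * 'I_d.+1)%type.
Local Notation n := #|{: T}|.

(* The diagonal entries of 1, x, x^2, ... for the generic element x; a Vandermonde
   matrix if x is diagonal. *)
Definition power_diag : 'M[{mpoly L[m]}]_n :=
  \matrix_(r, j) ((gmat (enum_val j).1 ^+ r) (enum_val j).2 (enum_val j).2).

Lemma power_diagE (v : 'rV[L]_m) : (\det power_diag).@[v 0] =
  \det (\matrix_(r < n, j < n) ((psi v (enum_val j).1 ^+ r) (enum_val j).2 (enum_val j).2)).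
Proof.
rewrite -det_map_mx; congr (\det _); apply/matrixP => r j; rewrite !mxE -gmatE.
by rewrite -rmorphXn mxE.
Qed.

Lemma power_diag_neq0 : \det power_diag != 0.
Proof.
have [s [us ss]] := inf_uniq (@closed_field_infinite L) n.
have [v vE] := psi_surj (fun k => diag_mx (\row_i s`_(enum_rank (k, i)))).
apply: contra_eq_neq (power_diagE v) => ->; rewrite meval0 eq_sym.
have -> : (\matrix_(r < n, j < n) ((psi v (enum_val j).1 ^+ r) (enum_val j).2 (enum_val j).2))
   = Vandermonde n (\row_(j < n) s`_j).
  apply/matrixP => r j; rewrite !mxE vE -[diag_mx _]horner_mx_X -rmorphXn /=.
  rewrite horner_mx_diag !mxE eqxx mulr1n hornerXn.
  by rewrite -surjective_pairing enum_valK.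
rewrite det_Vandermonde; apply/prodf_neq0 => i _; apply/prodf_neq0 => j ij.
rewrite !mxE subr_eq0 nth_uniq ?ss ?ltn_ord //.
by rewrite gtn_eqF.
Qed.

(** At an [F]-point where [power_diag] is invertible, the diagonal entries of p(a) = 0 give a linear
    relation among its rows, so a nonzero [p] has size above [n]. *)
Lemma cyclic_element : exists a : A, forall p : {poly F},
  p != 0 -> horner_alg a p = 0 -> (h * d.+1 < size p)%N.
Proof.
have [b] := mpoly_dense_neq infF iota power_diag_neq0.
have bE : iota \o b =1 ext_of iota (fvec b) 0 by move=> i; rewrite mxE fvecK.
rewrite (meval_eq _ bE) power_diagE => D0; exists (fvec b) => p p0 pa.
have nE : n = (h * d.+1)%N by rewrite card_prod !card_ord.
rewrite -nE ltnNge; apply: contra p0 => pn.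
pose c : 'rV[L]_n := \row_(r < n) iota p`_r.
set M := (X in \det X != 0) in D0.
have cM : c *m M = 0.
  apply/rowP => j; rewrite !mxE.
  have := congr1 (fun X : 'M_d.+1 => X (enum_val j).2 (enum_val j).2)
     (sigma_horner (enum_val j).1 (fvec b) p).
  rewrite pa sigma0 mxE => e; rewrite [RHS]e {e}.
  have -> : p = \sum_(r < n) p`_r *: 'X^r.
    rewrite -[p in LHS]coefK poly_def (big_ord_widen n (fun r => p`_r *: 'X^r) pn).
    rewrite [RHS](bigID (fun r : 'I_n => (r < size p)%N)) /=.
    rewrite [X in _ = _ + X]big1 ?addr0 // => r.
    by rewrite -leqNgt => /(nth_default 0) ->; rewrite scale0r.
  rewrite !rmorph_sum summxE; apply: eq_bigr => r _ /=.
  rewrite map_polyZ map_polyXn linearZ /= rmorphXn /= horner_mx_X.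
  by rewrite !mxE.
have c0 : c = 0.
  have Mu : M \in unitmx by rewrite unitmxE unitfE.
  by rewrite -[c]mulmx1 -(mulmxV Mu) mulmxA cM mul0mx.
apply/eqP/polyP => r; rewrite coef0.
have [rn|rn] := ltnP r n; last by rewrite nth_default // (leq_trans pn).
have := congr1 (fun X : 'rV_n => X 0 (Ordinal rn)) c0; rewrite !mxE /= => /eqP.
by rewrite fmorph_eq0 => /eqP.
Qed.

(** A common root over [L] makes [c] the difference of a root of [g] and a root of [p], which
    excludes only finitely many [c]. *)
Lemma coprime_shift (p g : {poly F}) : p != 0 -> g != 0 ->
  exists c, coprimep (p \Po ('X - c%:P)) g.
Proof.
move=> p0 g0.
have [rp pE] := closed_field_poly_normal (map_poly iota p).
have [rg gE] := closed_field_poly_normal (map_poly iota g).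
have lp : lead_coef (map_poly iota p) != 0 by rewrite lead_coef_eq0 map_poly_eq0.
have lg : lead_coef (map_poly iota g) != 0 by rewrite lead_coef_eq0 map_poly_eq0.
pose s := [seq x - y | x <- rg, y <- rp].
have [|c cs] := poly_dense_neq infF iota (p := \prod_(z <- s) ('X - z%:P)).
  exact: monic_neq0 (monic_prod_XsubC _ _ _).
exists c; rewrite -(coprimep_map iota); apply/Pdiv.ClosedField.coprimepP => x.
rewrite map_comp_poly rmorphB /= map_polyX map_polyC /= /root horner_comp.
rewrite hornerD hornerN hornerX hornerC => px; apply/negP => gx.
case/negP: cs; rewrite -/(root _ _) root_prod_XsubC; apply/allpairsP.
exists (x, x - iota c); split=> /=; last by rewrite subKr.
  by move: gx; rewrite gE hornerZ mulf_eq0 (negbTE lg) /= -/(root _ _) root_prod_XsubC.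
by move: px; rewrite pE hornerZ mulf_eq0 (negbTE lp) /= -/(root _ _) root_prod_XsubC.
Qed.

End Redpoly.
End Split.

(** The interface between a single factor and the rest of the proof, freed from [L], [iota] and
    [psi]; [n] is the degree of the norm. *)
Record norm_spec (F : fieldType) (A : falgType F) (N : A -> F)
    (N0 : {mpoly F[\dim {:A}]}) (n : nat) : Prop := NormSpec {
  nsM : multiplicative_fun N;
  ns_scalar : forall t, N t%:A = t ^+ n;
  ns_gt0 : (0 < n)%N;
  ns_rep : poly_fun_rep N N0;
  ns_irr : forall Q1 Q2, N0 = Q1 * Q2 -> mconst Q1 \/ mconst Q2;
  ns_dvd : forall (f : A -> F) P, poly_fun_rep f P -> multiplicative_fun f -> f 1 = 1 ->
    ~~ mconst P -> exists G, P = N0 * G;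
  ns_char : forall a, exists p : {poly F},
    [/\ p \is monic, size p = n.+1, forall t, p.[t] = N (t%:A - a) & horner_alg a p = 0];
  ns_cyclic : exists a : A, forall p : {poly F}, p != 0 -> horner_alg a p = 0 -> (n < size p)%N;
  ns_coprime : forall p g : {poly F}, p != 0 -> g != 0 ->
    exists c, coprimep (p \Po ('X - c%:P)) g
}.

Lemma reduced_norm_spec (F : fieldType) (infF : forall s : seq F, exists x : F, x \notin s)
    (A : falgType F) (N : A -> F) :
  simple_alg A -> is_reduced_norm N -> exists N0 n, norm_spec N N0 n.
Proof.
move=> As [L [iota [_ [h [[|d] [psi [lin [inj [surj [mul [one NE]]]]]]]]]]].
  (* Matrices of size 0 are all equal, so injectivity of [psi] would force 1 = 0 in [A]. *)
  have : ext_one A iota = 0.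
    by apply: inj => k; apply/matrixP => -[].
  move/rowP => e; have : (1 : A) = 0.
    rewrite [LHS]fcrdK big1 // => i _; have /eqP := e i.
    by rewrite !mxE fmorph_eq0 => /eqP ->; rewrite scale0r.
  by move/eqP; rewrite oner_eq0.
have [N0 N0E] := redpoly_exists infF lin NE.
exists N0, (h * d.+1)%N; split.
- exact: (reduced_normM mul NE).
- exact: (reduced_norm_scalar lin one NE).
- by rewrite muln_gt0 (h_gt0 iota inj).
- exact: (redpoly_rep lin NE N0E).
- exact: (redpoly_irreducible infF lin inj surj mul one As N0E).
- exact: (redpoly_dvd infF lin inj surj mul one As NE N0E).
- exact: (reduced_char_poly lin inj mul one As NE N0E).
- exact: (cyclic_element infF lin surj mul one).
- exact: (coprime_shift infF iota).
Qed.

(** * Multiplicative polynomial functions *)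

Section PolynomialFunctions.
Variables (F : fieldType) (infF : forall s : seq F, exists x : F, x \notin s).

Lemma poly_rep_inj (A : falgType F) (P P' : {mpoly F[\dim {:A}]}) :
  (forall a : A, P.@[fcrd a] = P'.@[fcrd a]) -> P = P'.
Proof.
move=> H; apply/eqP; rewrite -subr_eq0; apply/eqP; apply: (mpoly_denseF infF) => x.
have xE : x =1 fcrd (fvec x : A) by move=> i; rewrite fvecK.
by rewrite (meval_eq _ xE) mevalB H subrr.
Qed.

Lemma mconstP n (P : {mpoly F[n]}) : reflect (exists c, P = c%:MP) (mconst P).
Proof.
apply: (iffP idP) => [/msize1_polyC ->|[c ->]]; first by eexists.
by rewrite /mconst msizeC; case: (_ != 0).
Qed.

(** Pullback along an affine map; it restricts functions on [R] to a factor and, through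
    [hom_subst], lifts functions on a factor to [R]. *)
Lemma affine_subst (A B : falgType F) (P : {mpoly F[\dim {:A}]}) (r0 : A)
    (r : 'I_(\dim {:B}) -> A) : exists P' : {mpoly F[\dim {:B}]},
  forall s : B, P'.@[fcrd s] = P.@[fcrd (r0 + \sum_l fcrd s l *: r l)].
Proof.
exists (mmap (@mpolyC _ F) (fun i => (fcrd r0 i)%:MP + \sum_l fcrd (r l) i *: 'X_l) P) => s.
rewrite {1}/meval rmorph_mmap; apply: eq_mmap => [c|i] /=.
  by rewrite -/(meval _ _) mevalC.
rewrite -/(meval _ _) mevalD mevalC raddf_sum -[r0 in RHS]scale1r fcrd_is_linear mul1r.
rewrite fcrd_sum; congr (_ + _); apply: eq_bigr => l _.
by rewrite /= mevalZ mevalXU mulrC.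
Qed.

Lemma line_subst (A : falgType F) (P : {mpoly F[\dim {:A}]}) (a b : A) :
  exists p : {poly F}, forall t, p.[t] = P.@[fcrd (a + t *: b)].
Proof.
exists (mmap polyC (fun i => (fcrd a i)%:P + fcrd b i *: 'X) P) => t.
rewrite -horner_evalE rmorph_mmap; apply: eq_mmap => [c|i] /=.
  by rewrite horner_evalE hornerC.
rewrite horner_evalE [a + _]addrC fcrd_is_linear hornerD hornerC hornerZ hornerX.
by rewrite addrC mulrC.
Qed.

Section Hom.
Variables (A B : falgType F) (g : A -> B) (hg : alg_hom g).

Lemma alg_homD a b : g (a + b) = g a + g b.
Proof. by have [l _ _] := hg; rewrite -[a in LHS]scale1r l scale1r. Qed.

Lemma alg_hom0 : g 0 = 0.
Proof. by apply: (addrI (g 0)); rewrite -alg_homD !addr0. Qed.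

Lemma alg_homZ c a : g (c *: a) = c *: g a.
Proof. by have [l _ _] := hg; rewrite -[c *: a]addr0 l alg_hom0 addr0. Qed.

Lemma alg_homB a b : g (a - b) = g a - g b.
Proof. by rewrite alg_homD -scaleN1r alg_homZ scaleN1r. Qed.

Lemma alg_homM a b : g (a * b) = g a * g b.
Proof. by have [_ ->] := hg. Qed.

Lemma alg_hom1 : g 1 = 1.
Proof. by have [_ _ ->] := hg. Qed.

Lemma alg_hom_sum (I : Type) (s : seq I) (P : pred I) (x : I -> A) :
  g (\sum_(i <- s | P i) x i) = \sum_(i <- s | P i) g (x i).
Proof. exact: (big_morph g alg_homD alg_hom0). Qed.

Lemma alg_hom_prod (I : Type) (s : seq I) (P : pred I) (x : I -> A) :
  g (\prod_(i <- s | P i) x i) = \prod_(i <- s | P i) g (x i).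
Proof. exact: (big_morph g alg_homM alg_hom1). Qed.

Lemma alg_hom_fcrd a : g a = \sum_i fcrd a i *: g (fbas i).
Proof. by rewrite {1}[a]fcrdK alg_hom_sum; apply: eq_bigr => i _; rewrite alg_homZ. Qed.

Lemma alg_hom_horner a p : g (horner_alg a p) = horner_alg (g a) p.
Proof.
elim/poly_ind: p => [|p c IH]; first by rewrite !rmorph0 alg_hom0.
rewrite !rmorphD !rmorphM /= !horner_algX !horner_algC alg_homD alg_homM alg_homZ.
by rewrite IH alg_hom1.
Qed.

Lemma hom_subst (P : {mpoly F[\dim {:B}]}) : exists P' : {mpoly F[\dim {:A}]},
  forall a, P'.@[fcrd a] = P.@[fcrd (g a)].
Proof.
have [P' P'E] := @affine_subst B A P 0 (fun l => g (fbas l)).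
by exists P' => a; rewrite P'E add0r -alg_hom_fcrd.
Qed.

End Hom.

Lemma alg_homT (A B C : falgType F) (g : A -> B) (g' : B -> C) :
  alg_hom g -> alg_hom g' -> alg_hom (g' \o g).
Proof.
move=> hg hg'; split=> [c a b|a b|] /=.
- by rewrite (alg_homD hg) (alg_homZ hg) (alg_homD hg') (alg_homZ hg').
- by rewrite (alg_homM hg) (alg_homM hg').
- by rewrite (alg_hom1 hg) (alg_hom1 hg').
Qed.

Lemma algebraic_element (A : falgType F) (a : A) :
  exists2 p : {poly F}, p != 0 & horner_alg a p = 0.
Proof.
apply: NNPP => H; pose X := [tuple a ^+ i | i < (\dim {:A}).+1].
suff: free X.
  rewrite /free size_tuple => /eqP e.
  by have := dimvS (subvf <<X>>); rewrite e ltnn.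
apply/freeP => c c0 i.
pose p : {poly F} := \sum_(j < (\dim {:A}).+1) c j *: 'X^j.
have p0 : p = 0.
  apply/eqP; apply: contraT => pn; case: H; exists p => //.
  rewrite -[RHS]c0 /p rmorph_sum; apply: eq_bigr => j _ /=.
  by rewrite linearZ /= rmorphXn /= horner_algX -[in RHS](tnth_nth 0 X) tnth_mktuple mulr_algl.
have := congr1 (fun p : {poly F} => p`_i) p0; rewrite coef0 /p coef_sum (bigD1 i) //=.
rewrite coefZ coefXn eqxx mulr1 big1 ?addr0 // => j ji.
by rewrite coefZ coefXn eq_sym -[(_ == _ :> nat)]/(j == i) (negbTE ji) mulr0.
Qed.

(** An annihilating polynomial of [a] is g X^r with g(0) nonzero. Then g(a) is a nonzero scalar
    times some 1 - x a, hence a unit, and a^r = 0. *)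
Lemma jacobson_nil (A : falgType F) (a : A) : jacobson a -> exists r, a ^+ r = 0.
Proof.
move=> Ja; have [p p0 pa] := algebraic_element a.
have [r [g]] := multiplicity_XsubC p 0; rewrite p0 subr0 => /= g0 pE; exists r.
move: g0 pE; elim/poly_ind: g => [|g c _]; first by rewrite root0.
rewrite /root hornerD hornerMX mulr0 hornerC add0r => c0 pE.
have u : horner_alg a (g * 'X + c%:P) \is a GRing.unit.
  have -> : horner_alg a (g * 'X + c%:P) = c *: (1 - (- c^-1 *: horner_alg a g) * a).
    rewrite rmorphD rmorphM /= horner_algX horner_algC scalerBr -scalerAl scalerA.
    by rewrite mulrN divff // scaleN1r opprK addrC.
  by rewrite scaler_unit ?unitfE.
apply: (mulrI u); rewrite mulr0 -[RHS]pa pE rmorphM rmorphXn /=.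
by rewrite horner_algX.
Qed.

(** X + t divides p - p(-t); evaluated at [a], this makes a + t a divisor of a nonzero scalar. *)
Lemma translate_unit (A : falgType F) (a : A) (p : {poly F}) t :
  horner_alg a p = 0 -> p.[- t] != 0 -> a + t%:A \is a GRing.unit.
Proof.
move=> pa pt; have : root (p - p.[- t]%:P) (- t) by rewrite /root !hornerE subrr.
move=> /factor_theorem[g gE].
have e : horner_alg a g * (a + t%:A) = - (p.[- t])%:A.
  have := congr1 (horner_alg a) gE.
  rewrite rmorphB rmorphM /= rmorphB /= horner_algX !horner_algC pa sub0r => ->.
  by rewrite scaleNr opprK.
have cm : horner_alg a g * (a + t%:A) = (a + t%:A) * horner_alg a g.
  have -> : a + t%:A = horner_alg a ('X + t%:P).
    by rewrite rmorphD /= horner_algX horner_algC.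
  by rewrite -!rmorphM mulrC.
have i : - (p.[- t])^-1 *: - (p.[- t])%:A = 1 :> A.
  by rewrite scalerN scaleNr opprK scalerA mulVf // scale1r.
apply/unitrP; exists (- (p.[- t])^-1 *: horner_alg a g); split.
  by rewrite -scalerAl e.
by rewrite -scalerAr -cm e.
Qed.

Section Multiplicative.
Variables (A : falgType F) (f : A -> F) (P : {mpoly F[\dim {:A}]}).
Hypotheses (fP : poly_fun_rep f P) (fM : multiplicative_fun f) (f1 : f 1 = 1).

(* With p t = f (1 + t a), induction on the nilpotency index gives
   p t * p (- t) = f (1 - t^2 a^2) = 1, hence p is constant. *)
Lemma mult_fun_unipotent (a : A) s t : a ^+ (2 ^ s) = 0 -> f (1 + t *: a) = 1.
Proof.
elim: s a t => [|s IH] a t; first by rewrite expr1 => ->; rewrite scaler0 addr0.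
rewrite expnS exprM => /IH IHa.
have [p pE] := line_subst P 1 a.
have pf u : p.[u] = f (1 + u *: a) by rewrite pE fP.
have e : p * (p \Po - 'X) = 1.
  apply/eqP; rewrite -subr_eq0; apply/eqP.
  apply: (poly_dense infF (iota := idfun)) => u /=.
  rewrite hornerD hornerN hornerM horner_comp hornerN hornerX hornerC !pf -fM.
  have -> : (1 + u *: a) * (1 + - u *: a) = 1 + - (u * u) *: a ^+ 2.
    rewrite !scaleNr mulrDl mul1r mulrBr mulr1 addrA subrK.
    by rewrite -scalerAl -scalerAr scalerA expr2.
  by rewrite IHa subrr.
have : size (p * (p \Po - 'X)) == 1 by rewrite e size_poly1.
rewrite size_mul_eq1 => /andP[/size_poly1P[c _ pc] _].
by have := pf 0; have := pf t; rewrite pc !hornerC scale0r addr0 f1 => <-.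
Qed.

(** For a unit u, f(u + b) = f(u) f(1 + u^-1 b) with u^-1 b nilpotent. A general [a] is reached from
    the units a + t, both sides being polynomial in t. *)
Lemma mult_fun_jacobson (a b : A) :
  (forall x, jacobson (x * b)) -> f (a + b) = f a.
Proof.
move=> Jb.
have unitE u : u \is a GRing.unit -> f (u + b) = f u.
  move=> uu; have [r r0] := jacobson_nil (Jb u^-1).
  have -> : u + b = u * (1 + 1 *: (u^-1 * b)) by rewrite mulrDr mulr1 scale1r mulVKr.
  rewrite fM (@mult_fun_unipotent _ r 1) ?mulr1 //.
  by rewrite -(subnK (ltnW (ltn_expl r (ltnSn 1)))) exprD r0 mulr0.
have [g g0 ga] := algebraic_element a.
have [p1 p1E] := line_subst P (a + b) 1.
have [p2 p2E] := line_subst P a 1.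
(* The second factor vanishes at the values t where a + t may fail to be a unit. *)
have : (p1 - p2) * (g \Po - 'X) = 0.
  apply: (poly_dense infF (iota := idfun)) => t /=.
  rewrite hornerM horner_comp hornerN hornerX.
  have [->|gt] := eqVneq g.[- t] 0; first by rewrite mulr0.
  have := unitE _ (translate_unit ga gt).
  rewrite addrAC !fP -p1E -p2E hornerD hornerN => ->.
  by rewrite subrr mul0r.
move/eqP; rewrite mulf_eq0 => /orP[|]; last first.
  by rewrite -size_poly_eq0 size_comp_poly2 ?size_polyN ?size_polyX // size_poly_eq0 (negbTE g0).
rewrite subr_eq0 => /eqP/(congr1 (fun p : {poly F} => p.[0])).
by rewrite p1E p2E !scale0r !addr0 -!fP.
Qed.

End Multiplicative.

(** Factors are split off one at a time: a constant one is absorbed in the scalar, and otherwise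
    irreducibility makes the remaining product constant. *)
Lemma mirreducible_prod n k (P : {mpoly F[n]}) (Q : 'I_k -> {mpoly F[n]}) :
  mirreducible P -> P = \prod_i Q i -> exists i c, P = c *: Q i.
Proof.
move=> [Pn Pirr]; rewrite -[X in _ = X]scale1r; move: (index_enum _) (1 : F).
elim=> [|i s IH] c.
  move=> e; case/negP: Pn; apply/mconstP; exists c.
  by rewrite e big_nil -alg_mpolyC.
rewrite big_cons scalerAl => /[dup] e /Pirr[] /mconstP[c' c'E].
  by apply: (IH c'); rewrite e c'E mul_mpolyC.
by exists i, (c' * c); rewrite e c'E mulrC mul_mpolyC scalerA.
Qed.

End PolynomialFunctions.

(** * Multiplicative functions on R and the simple factors of R/J *)

Section SemisimpleQuotient.
Variables (F : fieldType) (infF : forall s : seq F, exists x : F, x \notin s).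
Variables (R Q : falgType F) (q : R -> Q) (hq : alg_hom q).
Hypothesis qsurj : forall b : Q, exists a : R, q a = b.
Hypothesis qker : forall a : R, q a = 0 <-> jacobson a.
Variables (k : nat) (S : 'I_k -> falgType F) (pi : forall i, Q -> S i).
Hypothesis hpi : forall i, alg_hom (pi i).
Hypothesis pinj : forall b : Q, (forall i, pi i b = 0) -> b = 0.
Hypothesis psurj : forall s : (forall i, S i), exists b : Q, forall i, pi i b = s i.

Let rho i : R -> S i := pi i \o q.

Lemma rho_hom i : alg_hom (@rho i).
Proof. exact: alg_homT. Qed.

Lemma rho_lift i (x : S i) (z : forall j, S j) :
  exists r, rho i r = x /\ forall j, j != i -> rho j r = z j.
Proof.
have [b bE] := psurj (dfwith z x); have [r rb] := qsurj b; exists r; split.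
  by rewrite /rho /= rb bE dfwith_in.
by move=> j ji; rewrite /rho /= rb bE dfwith_out // eq_sym.
Qed.

(** This section of [rho i] is affine, so composing with it turns polynomials on [R] into
    polynomials on [S i]. *)
Lemma affine_lift i : exists (r0 : R) (r : 'I_(\dim {:S i}) -> R),
  forall s, rho i (r0 + \sum_l fcrd s l *: r l) = s /\
    forall j, j != i -> rho j (r0 + \sum_l fcrd s l *: r l) = 1.
Proof.
have [r0 [r0i r0j]] := rho_lift (0 : S i) (fun j => 1).
have [r rE] := fin_all_exists (fun l : 'I_(\dim {:S i}) => rho_lift (fbas l) (fun j => 0)).
exists r0, r => s; split=> [|j ji]; rewrite (alg_homD (rho_hom _)) (alg_hom_sum (rho_hom _)).
  rewrite r0i add0r [RHS]fcrdK; apply: eq_bigr => l _.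
  by rewrite (alg_homZ (rho_hom _)) (rE l).1.
rewrite r0j // big1 ?addr0 // => l _.
by rewrite (alg_homZ (rho_hom _)) (rE l).2 // scaler0.
Qed.

Lemma linear_lift i : exists r : 'I_(\dim {:S i}) -> R,
  forall s, rho i (0 + \sum_l fcrd s l *: r l) = s.
Proof.
have [r rE] := fin_all_exists (fun l : 'I_(\dim {:S i}) => rho_lift (fbas l) (fun j => 0)).
exists r => s; rewrite add0r (alg_hom_sum (rho_hom _)) [RHS]fcrdK; apply: eq_bigr => l _.
by rewrite (alg_homZ (rho_hom _)) (rE l).1.
Qed.

Section Factor.
Variables (f : R -> F) (P : {mpoly F[\dim {:R}]}).
Hypotheses (fP : poly_fun_rep f P) (fM : multiplicative_fun f) (f1 : f 1 = 1).

Lemma mult_fun_rho a b : (forall i, rho i a = rho i b) -> f a = f b.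
Proof.
move=> ab; rewrite -[a](subrK b) addrC.
apply: (mult_fun_jacobson infF fP fM f1) => x; apply/qker.
rewrite (alg_homM hq) (alg_homB hq); apply/pinj => i.
rewrite (alg_homM (hpi i)) (alg_homB (hpi i)).
by have := ab i; rewrite /rho /= => ->; rewrite subrr mulr0.
Qed.

(** [g] is [f] composed with the affine section. The section is multiplicative only modulo the
    radical, which [f] does not see. *)
Lemma mult_fun_factor i : exists (g : S i -> F) (G : {mpoly F[\dim {:S i}]}),
  [/\ poly_fun_rep g G, multiplicative_fun g, g 1 = 1 &
   forall a, (forall j, j != i -> rho j a = 1) -> f a = g (rho i a)].
Proof.
have [r0 [r rE]] := affine_lift i.
have [G GE] := @affine_subst F R (S i) P r0 r.
pose lam s := r0 + \sum_l fcrd s l *: r l.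
exists (f \o lam), G; split=> [s|s t| |a ai] /=.
- by rewrite GE fP.
- rewrite -fM; apply: mult_fun_rho => j; rewrite (alg_homM (rho_hom _)).
  have [->|ji] := eqVneq j i; first by rewrite !(rE _).1.
  by rewrite !(rE _).2 // mulr1.
- rewrite -f1; apply: mult_fun_rho => j; rewrite (alg_hom1 (rho_hom _)).
  have [->|ji] := eqVneq j i; first by rewrite (rE _).1.
  by rewrite (rE _).2.
- apply: mult_fun_rho => j.
  have [->|ji] := eqVneq j i; first by rewrite (rE _).1.
  by rewrite (rE _).2 // ai.
Qed.

(* f is the product of its restrictions to the factors, so by irreducibility it
   coincides with one of them. *)
Lemma irreducible_factor : mirreducible P ->
  exists i (g : S i -> F) (G : {mpoly F[\dim {:S i}]}),
  [/\ poly_fun_rep g G, multiplicative_fun g, g 1 = 1 & forall a, f a = g (rho i a)].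
Proof.
move=> Pirr.
have [mu muE] := fin_all_exists (fun i => mult_fun_factor i).
have H i : exists Pi : {mpoly F[\dim {:R}]}, forall a, Pi.@[fcrd a] = mu i (rho i a).
  have [G [gG _ _ _]] := muE i; have [Pi PiE] := hom_subst (rho_hom i) G.
  by exists Pi => a; rewrite PiE gG.
have [Pi PiE] := fin_all_exists H.
have one i : mu i 1 = 1 by have [G []] := muE i.
have lift1 i a : exists b, rho i b = rho i a /\ forall j, j != i -> rho j b = 1.
  exact: rho_lift.
have prodE : P = \prod_i Pi i.
  apply: (poly_rep_inj infF) => a; rewrite -fP.
  (* [b i] agrees with [a] in component [i] and is 1 elsewhere, so the product of the [b i] has the
     components of [a]. *)
  have [b bE] := fin_all_exists (fun i => lift1 i a).
  have -> : f a = f (\prod_i b i).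
    apply: mult_fun_rho => j; rewrite (alg_hom_prod (rho_hom _)).
    rewrite (big_only1 j) //= ?(bE j).1 // => i ij _.
    by rewrite (bE i).2 // eq_sym.
  rewrite (big_morph f fM f1) rmorph_prod; apply: eq_bigr => i _ /=.
  have [G [_ _ _ ->]] := muE i; last exact: (bE i).2.
  by rewrite PiE (bE i).1.
have [i [c Pc]] := mirreducible_prod Pirr prodE.
have [G [gG gM g1 _]] := muE i.
exists i, (mu i), G; split=> // a.
have fE b : f b = c * mu i (rho i b) by rewrite fP Pc mevalZ PiE.
have := fE 1; rewrite f1 (alg_hom1 (rho_hom i)) g1 mulr1 => c1.
by rewrite fE -c1 mul1r.
Qed.

End Factor.

Section Norms.
Variables (i : 'I_k) (N : S i -> F) (N0 : {mpoly F[\dim {:S i}]}) (n : nat).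
Hypothesis NS : norm_spec N N0 n.

Lemma norm1 : N 1 = 1.
Proof. by rewrite -[1]scale1r (ns_scalar NS) expr1n. Qed.

Lemma norm0 : N 0 = 0.
Proof. by rewrite -(scale0r (1 : S i)) (ns_scalar NS) expr0n eqn0Ngt (ns_gt0 NS). Qed.

Lemma norm_rho_nconst (P : {mpoly F[\dim {:R}]}) :
  (forall a, P.@[fcrd a] = N (rho i a)) -> ~~ mconst P.
Proof.
move=> PE; apply/mconstP => -[c Pc].
have := PE 0; have := PE 1; rewrite Pc !mevalC (alg_hom0 (rho_hom i)) (alg_hom1 (rho_hom i)).
by rewrite norm1 norm0 => -> /eqP; rewrite oner_eq0.
Qed.

(** [N0] divides [G], which pulls back to a factorization of [P]; the cofactor is constant by
    irreducibility, and it is 1 at the unit element. *)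
Lemma mult_fun_norm (f : R -> F) (P : {mpoly F[\dim {:R}]}) (g : S i -> F) G :
  poly_fun_rep f P -> mirreducible P ->
  poly_fun_rep g G -> multiplicative_fun g -> g 1 = 1 -> (forall a, f a = g (rho i a)) ->
  forall a, f a = N (rho i a).
Proof.
move=> fP [Pn Pirr] gG gM g1 fg.
have [|H GH] := ns_dvd NS gG gM g1.
  apply: contra Pn => /mconstP[c Gc]; apply/mconstP; exists c.
  by apply: (poly_rep_inj infF) => a; rewrite -fP fg gG Gc !mevalC.
have [Q1 Q1E] := hom_subst (rho_hom i) N0.
have [Q2 Q2E] := hom_subst (rho_hom i) H.
have PQ : P = Q1 * Q2.
  by apply: (poly_rep_inj infF) => a; rewrite mevalM -fP fg gG GH mevalM Q1E Q2E.
have [|/mconstP[c Qc] a] := Pirr _ _ PQ.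
  by rewrite (negbTE (norm_rho_nconst _)) // => a; rewrite Q1E (ns_rep NS).
have fE b : f b = N (rho i b) * c.
  by rewrite fP PQ mevalM Q1E Qc mevalC (ns_rep NS).
have := fE 1; rewrite fg (alg_hom1 (rho_hom i)) norm1 g1 mul1r => c1.
by rewrite fE -c1 mulr1.
Qed.

Lemma norm_factor_const (P Q1 Q2 : {mpoly F[\dim {:R}]}) (r : 'I_(\dim {:S i}) -> R)
    (G : {mpoly F[\dim {:S i}]}) :
  (forall a, P.@[fcrd a] = N (rho i a)) -> P = Q1 * Q2 ->
  (forall s, rho i (0 + \sum_l fcrd s l *: r l) = s) ->
  (forall s, G.@[fcrd s] = Q1.@[fcrd (0 + \sum_l fcrd s l *: r l)]) ->
  mconst G -> mconst Q1.
Proof.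
move=> PE PQ rE GE /mconstP[c Gc].
(* Along the fibres of rho i through a with P a != 0, Q1 * Q2 is a nonzero constant. *)
have Q1c a : P.@[fcrd a] != 0 -> Q1.@[fcrd a] = c.
  move=> Pa; set b := 0 + \sum_l fcrd (rho i a) l *: r l.
  have ab : rho i b = rho i a by rewrite rE.
  have -> : c = Q1.@[fcrd b] by rewrite -GE Gc mevalC.
  have [p1 p1E] := line_subst Q1 a (b - a).
  have [p2 p2E] := line_subst Q2 a (b - a).
  have : p1 * p2 = (P.@[fcrd a])%:P.
    apply/eqP; rewrite -subr_eq0; apply/eqP.
    apply: (poly_dense infF (iota := idfun)) => t /=.
    rewrite hornerD hornerN hornerM hornerC p1E p2E -mevalM -PQ !PE.
    rewrite (alg_homD (rho_hom i)) (alg_homZ (rho_hom i)) (alg_homB (rho_hom i)) ab.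
    by rewrite subrr scaler0 addr0 subrr.
  move/(congr1 (fun p : {poly F} => size p == 1)); rewrite size_mul_eq1 size_polyC Pa.
  move=> /andP[/size_poly1P[x _ p1x] _].
  have := p1E 1; have := p1E 0; rewrite p1x !hornerC scale0r scale1r addr0.
  by rewrite addrC subrK => <- <-.
have Pn : P != 0.
  by apply: contraNneq (norm_rho_nconst PE) => ->; apply/mconstP; exists 0; rewrite mpolyC0.
apply/mconstP; exists c; apply/eqP; rewrite -subr_eq0.
have /eqP : (Q1 - c%:MP) * P = 0.
  apply: (poly_rep_inj infF) => a; rewrite meval0 mevalM mevalB mevalC.
  have [->|/Q1c ->] := eqVneq P.@[fcrd a] 0; first by rewrite mulr0.
  by rewrite subrr mul0r.
by rewrite mulf_eq0 (negbTE Pn) orbF.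
Qed.

(** A factorization over [R] restricts along a linear section of [rho i] to one of [N0], where one
    factor is constant; [norm_factor_const] carries this back to [R]. *)
Lemma norm_irreducible (f : R -> F) :
  (forall a, f a = N (rho i a)) -> irred_mult_poly_fun f.
Proof.
move=> fN; split; last by move=> a b; rewrite !fN (alg_homM (rho_hom i)) (nsM NS).
have [P PE] := hom_subst (rho_hom i) N0.
have PN a : P.@[fcrd a] = N (rho i a) by rewrite PE (ns_rep NS).
exists P; split; first by move=> a; rewrite fN PN.
split; first exact: norm_rho_nconst.
move=> Q1 Q2 PQ; have [r rE] := linear_lift i.
have [G1 G1E] := @affine_subst F R (S i) Q1 0 r.
have [G2 G2E] := @affine_subst F R (S i) Q2 0 r.
have : N0 = G1 * G2.
  apply: (poly_rep_inj infF) => s; rewrite mevalM G1E G2E -mevalM -PQ PN rE.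
  by rewrite (ns_rep NS).
case/(ns_irr NS) => Gc; [left | right].
  exact: (norm_factor_const PN PQ rE G1E Gc).
by rewrite mulrC in PQ; apply: (norm_factor_const PN PQ rE G2E Gc).
Qed.

End Norms.

Lemma irred_mult_poly_fun_iff (N : forall i, S i -> F)
    (N0 : forall i, {mpoly F[\dim {:S i}]}) (n : 'I_k -> nat) :
  (forall i, norm_spec (N i) (N0 i) (n i)) -> forall f : R -> F,
  irred_mult_poly_fun f <-> exists i, forall a, f a = N i (pi i (q a)).
Proof.
move=> NS f; split=> [[[P [fP Pirr]] fM]|[i fN]]; last exact: (norm_irreducible (NS i)).
have f1 : f 1 = 1.
  (* If f(1) = 0, then [f] and with it [P] vanish, against irreducibility. *)
  have [f0|f0] := eqVneq (f 1) 0; last first.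
    by apply: (mulfI f0); rewrite -fM !mulr1.
  case: Pirr => /negP[]; apply/mconstP; exists 0; apply: (poly_rep_inj infF) => a.
  by rewrite mevalC -fP -[a]mulr1 fM f0 mulr0.
have [i [g [G [gG gM g1 fg]]]] := irreducible_factor fP fM f1 Pirr.
exists i => a; exact: (mult_fun_norm (NS i) fP Pirr gG gM g1 fg).
Qed.

End SemisimpleQuotient.

(** * The Cayley-Hamilton norm *)

Section CayleyHamilton.
Variables (F : fieldType) (infF : forall s : seq F, exists x : F, x \notin s).

Lemma horner_alg_shift (A : falgType F) (a : A) c G :
  horner_alg (a + c%:A) G = horner_alg a (G \Po ('X + c%:P)).
Proof.
elim/poly_ind: G => [|G x IH]; first by rewrite comp_poly0 !rmorph0.
rewrite comp_polyD comp_polyM comp_polyX comp_polyC !rmorphD !rmorphM /= !rmorphD /=.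
by rewrite !horner_algX !horner_algC IH.
Qed.

Lemma horner_alg_sum (A : falgType F) (a : A) (p : {poly F}) n : (size p <= n)%N ->
  horner_alg a p = \sum_(d < n) p`_d *: a ^+ d.
Proof.
move=> pn; have {1}-> : p = \sum_(d < n) p`_d *: 'X^d.
  rewrite -[p in LHS]coefK poly_def (big_ord_widen n (fun d => p`_d *: 'X^d) pn).
  rewrite [RHS](bigID (fun d : 'I_n => (d < size p)%N)) /=.
  rewrite [X in _ = _ + X]big1 ?addr0 // => d.
  by rewrite -leqNgt => /(nth_default 0) ->; rewrite scale0r.
rewrite rmorph_sum; apply: eq_bigr => d _ /=.
by rewrite linearZ /= mulr_algl rmorphXn /= horner_algX.
Qed.

Section GenericElement.
Variable Q : falgType F.
Local Notation m := (\dim {:Q}).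
Local Notation B := {mpoly F[m]}.
Local Notation toK := (@tofrac {mpoly F[m]}).

(** The multiplication [ext_mul] over the polynomial ring instead of its fraction field, so that
    powers of the generic element can be specialized. *)
Definition gmul (v w : 'rV[B]_m) : 'rV[B]_m :=
  \row_l \sum_i \sum_j v 0 i * w 0 j * (fcrd (fbas i * fbas j) l)%:MP.
Definition gpow d : 'rV[B]_m := iter d (gmul (\row_l 'X_l)) (\row_l (fcrd 1 l)%:MP).

Lemma gpow_frac d : ext_pow (@iotaK F Q) (gen_elt Q) d = map_mx toK (gpow d).
Proof.
elim: d => [|d IH]; first by apply/rowP => l; rewrite !mxE.
rewrite /ext_pow iterS -/(ext_pow _ _ _) IH /gpow iterS -/(gpow _).
apply/rowP => l; rewrite !mxE rmorph_sum; apply: eq_bigr => i _.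
by rewrite rmorph_sum; apply: eq_bigr => j _; rewrite !mxE !rmorphM.
Qed.

Lemma gpow_eval d (a : Q) l : (gpow d 0 l).@[fcrd a] = fcrd (a ^+ d) l.
Proof.
elim: d l => [|d IH] l; first by rewrite mxE mevalC.
rewrite /gpow iterS -/(gpow _) mxE raddf_sum exprS fcrdM; apply: eq_bigr => i _ /=.
rewrite raddf_sum; apply: eq_bigr => j _ /=.
by rewrite !mevalM mevalC mxE mevalXU IH.
Qed.

Lemma tofrac_inj : injective toK.
Proof. by move=> x y /eqP; rewrite tofrac_eq => /eqP. Qed.

(** The coordinates of chi(x) are polynomials in the coordinates of the generic element, and they
    vanish at every element of [Q]. *)
Lemma ext_horner_frac (chi : {poly B}) :
  (forall a : Q, horner_alg a (map_poly (meval (fcrd a)) chi) = 0) ->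
  ext_horner (@iotaK F Q) (map_poly toK chi) (gen_elt Q) = 0.
Proof.
move=> chi0; apply/rowP => l; rewrite summxE [RHS]mxE.
rewrite (eq_bigr (fun d : 'I_(size (map_poly toK chi)) => toK (chi`_d * gpow d 0 l))).
  rewrite -rmorph_sum; apply/eqP; rewrite tofrac_eq0; apply/eqP.
  apply: (poly_rep_inj infF) => a; rewrite meval0 raddf_sum /=.
  have -> : size (map_poly toK chi) = size chi.
    by rewrite size_map_inj_poly ?rmorph0 //; exact: tofrac_inj.
  have := congr1 (fun x => fcrd x l) (chi0 a).
  rewrite (@horner_alg_sum _ _ _ (size chi)) ?size_poly // fcrd_sum.
  rewrite {3}/fcrd linear0 => e; rewrite -[RHS]e.
  by apply: eq_bigr => d _; rewrite mevalM gpow_eval coef_map.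
by move=> d _; rewrite mxE gpow_frac mxE coef_map rmorphM.
Qed.

(* If 1, a, ..., a^(n-1) are independent over F, then a minor witnessing this is the
   specialization of a nonzero minor of the generic powers. *)
Lemma generic_size n (a : Q) :
  (forall p : {poly F}, p != 0 -> horner_alg a p = 0 -> (n < size p)%N) ->
  forall P : {poly genK Q}, P != 0 -> ext_horner (@iotaK F Q) P (gen_elt Q) = 0 ->
  (n < size P)%N.
Proof.
move=> amin P P0 Pg; rewrite ltnNge; apply: contra P0 => Pn.
pose W : 'M[B]_(n, m) := \matrix_(r, l) gpow r 0 l.
pose Wa := map_mx (meval (fcrd a)) W.
have Wfree : row_free Wa.
  rewrite -kermx_eq0; apply/eqP/row_matrixP => i; rewrite row0.
  have : row i (kermx Wa) *m Wa = 0 by rewrite -row_mul mulmx_ker row0.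
  move: (row i _) => c cW; apply/eqP; apply: contraT => c0.
  (* A kernel row [c] lists the coefficients of a polynomial of size at most [n] that annihilates
     [a]. *)
  have p0 : rVpoly c != 0.
    by apply: contra c0 => /eqP e; rewrite -[c]rVpolyK e linear0.
  have := amin _ p0; rewrite ltnNge size_poly => H; suff : false by []; apply: H.
  rewrite (@horner_alg_sum _ _ _ n) ?size_poly // [RHS]fcrdK [LHS]fcrdK.
  apply: eq_bigr => l _; congr (_ *: _); rewrite fcrd_sum /fcrd linear0 -/(fcrd _ _).
  have := congr1 (fun X : 'rV_m => X 0 l) cW; rewrite !mxE => e; rewrite -[RHS]e.
  by apply: eq_bigr => r _; rewrite !mxE coef_rVpoly_ord gpow_eval.
have Wfull : row_full Wa^T by rewrite /row_full mxrank_tr.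
pose D := \det (\matrix_(r, j) W r (fullrankfun Wfull j)).
have D0 : D != 0.
  have := fullrowsub_unit Wfull; rewrite unitmxE unitfE.
  apply: contraNneq => D0; rewrite -det_tr.
  have -> : (rowsub (fullrankfun Wfull) Wa^T)^T
      = map_mx (meval (fcrd a)) (\matrix_(r, j) W r (fullrankfun Wfull j)).
    by apply/matrixP => r j; rewrite !mxE.
  by rewrite det_map_mx -/D D0 rmorph0.
pose c : 'rV[genK Q]_n := \row_r P`_r.
pose WK := map_mx toK (\matrix_(r, j) W r (fullrankfun Wfull j)).
have WKu : WK \in unitmx by rewrite unitmxE unitfE det_map_mx tofrac_eq0.
have cW : c *m WK = 0.
  apply/rowP => j; rewrite !mxE.
  have := congr1 (fun X : 'rV_m => X 0 (fullrankfun Wfull j)) Pg.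
  rewrite /ext_horner summxE mxE => e; rewrite -[RHS]e.
  rewrite (big_ord_widen n (fun d => (P`_d *: ext_pow (@iotaK F Q) (gen_elt Q) d) 0 _) Pn).
  rewrite [LHS](bigID (fun d : 'I_n => (d < size P)%N)) /= addrC big1 ?add0r => [|d].
    by apply: eq_bigr => d _; rewrite gpow_frac !mxE.
  by rewrite -leqNgt => dP; rewrite !mxE nth_default ?mul0r.
have c0 : c = 0 by rewrite -[c]mulmx1 -(mulmxV WKu) mulmxA cW mul0mx.
apply/eqP/polyP => r; rewrite coef0.
have [rn|rn] := ltnP r n; last by rewrite nth_default // (leq_trans Pn).
by have := congr1 (fun X : 'rV_n => X 0 (Ordinal rn)) c0; rewrite !mxE.
Qed.

End GenericElement.

Section Product.
Variables (Q : falgType F) (k : nat) (S : 'I_k -> falgType F) (pi : forall i, Q -> S i).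
Hypothesis hpi : forall i, alg_hom (pi i).
Hypothesis pinj : forall b : Q, (forall i, pi i b = 0) -> b = 0.
Hypothesis psurj : forall s : (forall i, S i), exists b : Q, forall i, pi i b = s i.
Variables (N : forall i, S i -> F) (N0 : forall i, {mpoly F[\dim {:S i}]}) (n : 'I_k -> nat).
Hypothesis NS : forall i, norm_spec (@N i) (N0 i) (n i).

Lemma cyclic_min_poly i (a : S i) (p : {poly F}) :
  (forall g : {poly F}, g != 0 -> horner_alg a g = 0 -> (n i < size g)%N) ->
  p != 0 -> size p = (n i).+1 -> horner_alg a p = 0 ->
  forall g, horner_alg a g = 0 -> p %| g.
Proof.
move=> amin p0 sp pa g ga; rewrite /dvdp; apply: contraT => r0.
have ra : horner_alg a (g %% p) = 0.
  have := congr1 (horner_alg a) (divp_eq g p).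
  by rewrite ga rmorphD rmorphM /= pa mulr0 add0r.
have := amin _ r0 ra; rewrite ltnNge => /negP[].
by rewrite -ltnS -sp ltn_modp.
Qed.

(* Cyclic elements of the factors are shifted by scalars to make their minimal
   polynomials pairwise coprime. *)
Lemma product_cyclic_element : exists a : Q, forall p : {poly F},
  p != 0 -> horner_alg a p = 0 -> (\sum_i n i < size p)%N.
Proof.
have [a amin] := fin_all_exists (fun i => ns_cyclic (NS i)).
have [p pP] := fin_all_exists (fun i => ns_char (NS i) (a i)).
suff [c [D [sD DP]]] : exists (c : 'I_k -> F) (D : {poly F}),
    size D = (\sum_i n i).+1 /\
    forall G, (forall i, horner_alg (a i + (c i)%:A) G = 0) -> D %| G.
  have [b bE] := psurj (fun i => a i + (c i)%:A); exists b => G G0 Gb.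
  rewrite -sD dvdp_leq // DP // => i.
  by rewrite -bE -(alg_hom_horner (hpi i)) Gb (alg_hom0 (hpi i)).
suff [c [D [sD DP]]] : exists (c : 'I_k -> F) (D : {poly F}),
    size D = (\sum_(i <- index_enum 'I_k) n i).+1 /\
    forall G, (forall i, i \in index_enum 'I_k -> horner_alg (a i + (c i)%:A) G = 0) -> D %| G.
  by exists c, D; split=> // G GE; apply: DP => i _; apply: GE.
elim: (index_enum _) (index_enum_uniq 'I_k) => [_|i s IH /= /andP[ins us]].
  by exists (fun=> 0), 1; rewrite big_nil size_poly1; split=> // G _; apply: dvd1p.
have [c [D [sD DP]]] := IH us.
have [pm sp _ pa] := pP i.
have D0 : D != 0 by rewrite -size_poly_eq0 sD.
have [x cop] := ns_coprime (NS i) (monic_neq0 pm) D0.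
(* p_i(X - x) is the minimal polynomial of the shifted element, and [x] makes it coprime to [D]. *)
exists (fun j => if j == i then x else c j), ((p i \Po ('X - x%:P)) * D); split.
  have spx : size (p i \Po ('X - x%:P)) = (n i).+1.
    by rewrite size_comp_poly2 ?size_XsubC.
  rewrite big_cons size_mul ?spx ?sD // -?size_poly_eq0 ?spx //.
  by rewrite addnS addSn.
move=> G GE; rewrite Gauss_dvdp //; apply/andP; split.
  have := GE i (mem_head _ _); rewrite eqxx horner_alg_shift.
  move/(cyclic_min_poly (amin i) (monic_neq0 pm) sp pa).
  move/(dvdp_comp_poly ('X - x%:P)); rewrite -comp_polyA.
  by rewrite comp_polyD comp_polyX comp_polyC subrK comp_polyXr.
apply: DP => j js; have := GE j; rewrite inE js orbT => /(_ isT).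
by case: eqP js => // ->; rewrite (negbTE ins).
Qed.

Local Notation m := (\dim {:Q}).
Local Notation B := {mpoly F[m]}.

Lemma product_norm_CH : exists M : {mpoly F[m]},
  CH_norm_rep M /\ forall b : Q, \prod_(i < k) N (pi i b) = M.@[fcrd b].
Proof.
have [M' M'E] := fin_all_exists (fun i => hom_subst (hpi i) (N0 i)).
pose M := \prod_i M' i.
have ME b : \prod_(i < k) N (pi i b) = M.@[fcrd b].
  rewrite rmorph_prod; apply: eq_bigr => i _.
  by rewrite /= M'E (ns_rep (NS i)).
exists M; split=> //.
pose sn := (\sum_i n i)%N.
(* [chi] is M(t - x), with t its variable and x the generic element. *)
pose chi : {poly B} := mmap (polyC \o @mpolyC m F)
  (fun l => (fcrd (1 : Q) l)%:MP *: 'X - ('X_l)%:P) M.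
have chiE a t : (map_poly (meval (fcrd a)) chi).[t] = M.@[fcrd (t%:A - a)].
  rewrite -horner_evalE rmorph_mmap rmorph_mmap; apply: eq_mmap => [x|l] /=.
    by rewrite horner_evalE map_polyC hornerC /= mevalC.
  rewrite horner_evalE rmorphB /= map_polyZ map_polyX map_polyC /= mevalC mevalXU.
  rewrite hornerD hornerN hornerC hornerZ hornerX.
  by rewrite fcrd_is_linear mulrC /fcrd linearN.
have chiP a : [/\ map_poly (meval (fcrd a)) chi \is monic,
     size (map_poly (meval (fcrd a)) chi) = sn.+1
   & horner_alg a (map_poly (meval (fcrd a)) chi) = 0].
  have [p pP] := fin_all_exists (fun i => ns_char (NS i) (pi i a)).
  have -> : map_poly (meval (fcrd a)) chi = \prod_i p i.
    apply/eqP; rewrite -subr_eq0; apply/eqP.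
    apply: (poly_dense infF (iota := idfun)) => t /=.
    rewrite hornerD hornerN chiE -ME horner_prod; apply/eqP; rewrite subr_eq0; apply/eqP.
    apply: eq_bigr => i _; have [_ _ -> _] := pP i.
    by rewrite (alg_homB (hpi i)) (alg_homZ (hpi i)) (alg_hom1 (hpi i)).
  split.
  - by apply: monic_prod => i _; have [] := pP i.
  - rewrite size_prod => [|i _]; last by have [/monic_neq0] := pP i.
    rewrite (eq_bigr (fun i => (n i).+1)) => [|i _]; last by have [] := pP i.
    rewrite (eq_bigr (fun i => (n i + 1)%N)) => [|i _]; last by rewrite addn1.
    rewrite big_split /= sum1_card.
    by rewrite -addSn addnK.
  - apply: pinj => i; rewrite (alg_hom_horner (hpi i)) (bigD1 i) //= rmorphM /=.
    by have [_ _ _ ->] := pP i; rewrite mul0r.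
have coefE d a : (chi`_d).@[fcrd a] = (map_poly (meval (fcrd a)) chi)`_d.
  by rewrite coef_map.
have chin : chi`_sn = 1.
  apply: (poly_rep_inj infF) => a; rewrite coefE meval1.
  by have [/monicP + sa _] := chiP a; rewrite /lead_coef sa.
have schi : size chi = sn.+1.
  apply/eqP; rewrite eqn_leq; apply/andP; split.
    apply/leq_sizeP => d sd; apply: (poly_rep_inj infF) => a.
    by have [_ sa _] := chiP a; rewrite coefE meval0 nth_default ?sa.
  by rewrite ltnNge; apply/negP => /leq_sizeP/(_ sn (leqnn _))/eqP; rewrite chin oner_eq0.
have inj := @tofrac_inj Q.
have sP : size (map_poly (@tofrac B) chi) = sn.+1.
  by rewrite size_map_inj_poly ?rmorph0.
exists (map_poly (@tofrac B) chi); split; first split.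
- by rewrite monicE /lead_coef sP coef_map /= chin rmorph1.
- by apply: ext_horner_frac => // a; have [] := chiP a.
- have [a amin] := product_cyclic_element.
  by move=> P P0 Pg; rewrite sP; apply: (generic_size amin).
rewrite sP coef_map /= -[-1]/(- 1) -(rmorph1 (@tofrac B)) -rmorphN -rmorphXn -rmorphM.
congr tofrac; apply: (poly_rep_inj infF) => a.
(* The constant term at [a] is M(-a); the sign is split into the norms N_i(-1), which turn each
   N_i(-a) into N_i(a). *)
rewrite mevalM coefE -horner_coef0 chiE scale0r sub0r rmorphXn /= mevalN meval1 -!ME.
rewrite -prodrXr -big_split /=.
apply: eq_bigr => i _; rewrite -(ns_scalar (NS i)) -(nsM (NS i)).
by rewrite -scaleN1r (alg_homZ (hpi i)) -scalerAl mul1r scalerA mulrNN mulr1 scale1r.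
Qed.

End Product.
End CayleyHamilton.

Theorem theorem3p2 (F : fieldType) (infF : forall s : seq F, exists x : F, x \notin s)
  (R : falgType F)
  (* Q together with q : R -> Q realizes R/J *)
  (Q : falgType F) (q : R -> Q) (hq : alg_hom q)
  (qsurj : forall b : Q, exists a : R, q a = b)
  (qker : forall a : R, q a = 0 <-> jacobson a)
  (* R/J = (+)_i R_i, R_i simple with separable center, pi i the projections *)
  (k : nat) (S : 'I_k -> falgType F) (pi : forall i, Q -> S i)
  (hpi : forall i, alg_hom (pi i))
  (pinj : forall b : Q, (forall i, pi i b = 0) -> b = 0)
  (psurj : forall s : (forall i, S i), exists b : Q, forall i, pi i b = s i)
  (Ssimple : forall i, simple_alg (S i))
  (Ssep : forall i, center_separable (S i))
  (* N i is the reduced norm of R_i *)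
  (N : forall i, S i -> F) (hN : forall i, is_reduced_norm (N i)) :
  (forall f : R -> F,
      irred_mult_poly_fun f <-> exists i, forall a : R, f a = N i (pi i (q a)))
  /\ exists M : {mpoly F[\dim {:Q}]},
       CH_norm_rep M /\ forall b : Q, \prod_(i < k) N i (pi i b) = M.@[fcrd b].
Proof.
have [N0 N0E] := fin_all_exists (fun i => reduced_norm_spec infF (Ssimple i) (hN i)).
have [n NS] := fin_all_exists N0E.
split; first exact: (irred_mult_poly_fun_iff infF hq qsurj qker hpi pinj psurj NS).
exact: (product_norm_CH infF hpi pinj psurj NS).
Qed.
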